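(* Let $\mu>0$ and let $H$ be the integral transform defined for $f\in\mathcal S(\mathbb R)$ by $$(Hf)(t)=i^{1/6}\sqrt{2\mu}\int_{-\infty}^{\infty} f(x)\,e(2\mu tx-\mu x^2)\,dx,\qquad t\in\mathbb R.$$ Then $(H^3f)(t)=f(-t)$ for all $f\in\mathcal S(\mathbb R)$ and $t\in\mathbb R$, so that $H$ has period six (that is, $H^6=I$), and $H$ extends to a unitary operator on $L^2(\mathbb R)$. Further, its square $H^2$ is given by $$(H^2f)(t)=\frac{\sqrt{2\mu}}{i^{1/6}}\,e(\mu t^2)\int_{-\infty}^{\infty} f(x)\,e(2\mu tx)\,dx$$ for all $f\in\mathcal S(\mathbb R)$ and $t\in\mathbb R$.
   Context: Notation: $e(t):=e^{2\pi i t}$. $\mathcal S(\mathbb R)$ is the space of (complex-valued) Schwartz functions on $\mathbb R$; the transform $H$ maps $\mathcal S(\mathbb R)$ into itself, so its powers $H^k$ are defined on $\mathcal S(\mathbb R)$. Roots are principal, so $i^{1/6}=e^{\pi i/12}$. *)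

(* Defs.v *)
From HB Require Import structures.
From mathcomp Require Import all_boot all_order all_algebra.
From mathcomp Require Import complex.
From mathcomp Require Import all_classical all_reals all_analysis.

Set Implicit Arguments.
Unset Strict Implicit.
Unset Printing Implicit Defensive.

Import Order.TTheory GRing.Theory Num.Theory.
Import numFieldNormedType.Exports.

Local Open Scope classical_set_scope.
Local Open Scope ring_scope.
Local Open Scope complex_scope.

Section Transform.
Context {R : realType}.
Implicit Types (f g : R -> R[i]) (t x : R).

Local Notation leb := (@lebesgue_measure R).
Local Notation re := (@complex.Re R).
Local Notation im := (@complex.Im R).

Definition expi (theta : R) : R[i] := cos theta +i* sin theta.

Definition e t : R[i] := expi (2 * pi * t).

(* The principal value of i^(1/6): the argument is (pi / 2) / 6. *)
Definition i_root6 : R[i] := expi (pi / 12).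

Definition Cintegral f : R[i] :=
  (\int[leb]_x re (f x)) +i* (\int[leb]_x im (f x)).

(* R[i] carries no normed-module structure over R, so differentiation in a
   real variable is taken componentwise. *)
Definition Cderivn (n : nat) f x : R[i] :=
  ((re \o f)^`(n))%classic x +i* ((im \o f)^`(n))%classic x.

Definition smooth f : Prop :=
  forall (n : nat) x,
    derivable ((re \o f)^`(n))%classic x 1 /\
    derivable ((im \o f)^`(n))%classic x 1.

Definition schwartz f : Prop :=
  smooth f /\
  forall m n : nat, exists M : R,
    forall x, `| x%:C ^+ m * Cderivn n f x | <= M%:C.

(* H is total on functions; the integral is meaningful for integrable f, in
   particular for Schwartz functions. *)
Definition H (mu : R) f : R -> R[i] := fun t =>
  i_root6 * (Num.sqrt (2 * mu))%:C *
  Cintegral (fun x => f x * e (2 * mu * t * x - mu * x ^+ 2)).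

(* Elements of L^2 are represented by square-integrable functions, which are
   identified when they agree almost everywhere. *)
Definition L2 f : Prop :=
  [/\ measurable_fun setT (re \o f), measurable_fun setT (im \o f) &
      (\int[leb]_x ((ComplexField.Normc.normc (f x)) ^+ 2)%:E < +oo)%E].

Definition L2eq f g : Prop := {ae leb, forall x, f x = g x}.

Definition L2inner f g : R[i] := Cintegral (fun x => f x * conjc (g x)).

(* A map U on representatives that induces a well-defined operator on the
   quotient of L2 by L2eq. *)
Definition L2_operator (U : (R -> R[i]) -> (R -> R[i])) : Prop :=
  (forall f, L2 f -> L2 (U f)) /\
  (forall f g, L2 f -> L2 g -> L2eq f g -> L2eq (U f) (U g)).

Definition L2_linear (U : (R -> R[i]) -> (R -> R[i])) : Prop :=
  forall (a : R[i]) f g, L2 f -> L2 g ->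
    L2eq (U (fun x => a * f x + g x)) (fun x => a * U f x + U g x).

Definition L2_unitary (U : (R -> R[i]) -> (R -> R[i])) : Prop :=
  [/\ L2_operator U, L2_linear U,
      (forall f g, L2 f -> L2 g -> L2inner (U f) (U g) = L2inner f g) &
      (forall g, L2 g -> exists2 f, L2 f & L2eq (U f) g)].

End Transform.

(* Main.v *)
(* With [k = 4 pi mu], let [F] be the Fourier integral with kernel
   [expi (k t x)] and let [M] be multiplication by the chirp
   [expi (- k x^2 / 2)]; then [H = i^(1/6) sqrt(2 mu) F M].  Two identities on
   Schwartz functions give the algebraic claims: Fourier inversion
   [F F f (t) = (2 pi / k) f (- t)], and the Fresnel identity
   [F M F = sqrt(2 pi / k) e^(- i pi / 4) M^-1 F M^-1], which says that the
   Fourier transform of a chirp is a chirp.  Both arise from inserting a factor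
   [e^(- a y^2)] in the outer integral, exchanging the integrals, and letting
   [a] tend to 0 in the explicit Fourier transform of the complex Gaussian
   [e^(- (a + i b) y^2)], with [b = 0] and [b = k / 2] respectively.
   That transform is found by solving first-order linear differential equations
   in the frequency and in [b].

   The L2 claim follows since [H] is isometric on Schwartz functions (Fubini and
   inversion) and onto (its inverse is [H^5]), while Schwartz functions are dense
   in the complete space L2.  Density comes from
   [e^(- ((x - c) / r)^(2 n))] converging to the indicator of an interval,
   followed by a Dynkin argument. *)
Require Import Defs.
From HB Require Import structures.
From mathcomp Require Import all_boot all_order all_algebra.
From mathcomp Require Import complex finmap.
From mathcomp Require Import all_classical all_reals all_analysis.
From mathcomp Require Import ring lra zify.
From mathcomp Require Import measurable_realfun.
Import Order.TTheory GRing.Theory Num.Theory.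
Import numFieldNormedType.Exports.
Local Open Scope classical_set_scope.
Local Open Scope ring_scope.
Local Open Scope complex_scope.
Set Implicit Arguments.
Unset Strict Implicit.
Unset Printing Implicit Defensive.

(** * Complex-valued functions of a real variable *)

Section ComplexDerivative.
Context {R : realType}.
Implicit Types (f g : R -> R[i]) (t x y : R) (z w : R[i]).

Local Notation re := (@complex.Re R).
Local Notation im := (@complex.Im R).
Local Notation nc := (@ComplexField.Normc.normc R).

(** The iterated integrals in [F F] and [F M F] converge only through oscillation or the decay of
    the inner integral, so they cannot be exchanged as they stand; this is what the Gaussian factor
    repairs. After the exchange the two limits behave differently. For [b = k / 2] the modulus of
    the Gaussian transform stays below [sqrt(pi / b)] uniformly in [a], and dominated convergence
    suffices. For [b = 0] the transform concentrates at one point and has no integrable majorant, so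
    inversion rests on an explicit error bound instead, built from a Lipschitz constant and the
    second moment of the kernel.

    The constants in [H] are tuned to these limits. The Fresnel phase [e^(- i pi / 4)] is the
    limiting direction of [(a + i b)^(-1/2)], and the three factors [i^(1/6)] in [H^3] cancel it;
    the factor [2 pi / k] of inversion equals [1 / (2 mu)], which [sqrt(2 mu)] squared cancels. *)

Lemma complex_eq z w : re z = re w -> im z = im w -> z = w.
Proof. by case: z w => [a b] [c d] /= -> ->. Qed.

Lemma reD z w : re (z + w) = re z + re w. Proof. by case: z w => [a b] [c d]. Qed.
Lemma imD z w : im (z + w) = im z + im w. Proof. by case: z w => [a b] [c d]. Qed.
Lemma reN z : re (- z) = - re z. Proof. by case: z. Qed.
Lemma imN z : im (- z) = - im z. Proof. by case: z. Qed.
Lemma reM z w : re (z * w) = re z * re w - im z * im w.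
Proof. by case: z w => [a b] [c d]. Qed.
Lemma imM z w : im (z * w) = re z * im w + im z * re w.
Proof. by case: z w => [a b] [c d]. Qed.
Lemma reJ z : re (conjc z) = re z. Proof. by case: z. Qed.
Lemma imJ z : im (conjc z) = - im z. Proof. by case: z. Qed.
Definition reimE := (reD, imD, reN, imN, reM, imM, reJ, imJ).

Lemma conjcM z w : conjc (z * w) = conjc z * conjc w.
Proof. exact: rmorphM. Qed.

Lemma nc_real x : nc x%:C = `|x|.
Proof. by rewrite /= expr0n /= addr0 sqrtr_sqr. Qed.

Lemma ncE z : `|z| = (nc z)%:C. Proof. by case: z. Qed.

Lemma nc_ge0 z : 0 <= nc z. Proof. by case: z => a b; exact: sqrtr_ge0. Qed.

Lemma sqr_nc z : nc z ^+ 2 = re z ^+ 2 + im z ^+ 2.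
Proof. by case: z => a b /=; rewrite sqr_sqrtr // addr_ge0 ?sqr_ge0. Qed.

Lemma ncM z w : nc (z * w) = nc z * nc w.
Proof. exact: ComplexField.Normc.normcM. Qed.

Lemma ncD z w : nc (z + w) <= nc z + nc w.
Proof. by rewrite -lecR rmorphD /= -!ncE ler_normD. Qed.

Lemma ncN z : nc (- z) = nc z.
Proof. by apply: complexI; rewrite -!ncE normrN. Qed.

Lemma ncJ z : nc (conjc z) = nc z.
Proof. by case: z => a b /=; rewrite sqrrN. Qed.

Lemma nc_eq0 z : nc z = 0 -> z = 0.
Proof. exact: ComplexField.Normc.eq0_normc. Qed.

Lemma le_re_nc z : `|re z| <= nc z.
Proof.
by rewrite -[leRHS]ger0_norm ?nc_ge0 // -ler_sqr ?nnegrE ?normr_ge0 // !real_normK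
  ?num_real // sqr_nc lerDl sqr_ge0.
Qed.

Lemma le_im_nc z : `|im z| <= nc z.
Proof.
by rewrite -[leRHS]ger0_norm ?nc_ge0 // -ler_sqr ?nnegrE ?normr_ge0 // !real_normK
  ?num_real // sqr_nc lerDr sqr_ge0.
Qed.

Lemma nc_le_reim z : nc z <= `|re z| + `|im z|.
Proof.
rewrite -ler_sqr ?nnegrE ?nc_ge0 ?addr_ge0 // sqr_nc sqrrD !real_normK ?num_real //.
by rewrite -addrA lerD2l lerDr mulrn_wge0 // mulr_ge0.
Qed.

Lemma re_expi x : re (expi x) = cos x. Proof. by []. Qed.
Lemma im_expi x : im (expi x) = sin x. Proof. by []. Qed.

Lemma expiD x y : expi (x + y) = expi x * expi y.
Proof.
apply: complex_eq; rewrite !reimE ?re_expi ?im_expi ?cosD ?sinD //; ring.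
Qed.

Lemma expi0 : expi (0 : R) = 1.
Proof. by apply: complex_eq; rewrite ?re_expi ?im_expi ?cos0 ?sin0. Qed.

Lemma expiN x : expi (- x) = conjc (expi x).
Proof. by apply: complex_eq; rewrite !reimE ?re_expi ?im_expi ?cosN ?sinN. Qed.

Lemma expiNK x : expi (- x) * expi x = 1.
Proof. by rewrite -expiD addNr expi0. Qed.

Lemma nc_expi x : nc (expi x) = 1.
Proof. by rewrite /= cos2Dsin2 sqrtr1. Qed.

Lemma expi_neq0 x : expi x != 0.
Proof.
by apply/eqP => h; have := nc_expi x; rewrite h ComplexField.Normc.normc0 => /esym/eqP; rewrite oner_eq0.
Qed.

Lemma expiV x : (expi x)^-1 = expi (- x).
Proof. by apply: (mulIf (expi_neq0 x)); rewrite mulVf ?expi_neq0 // expiNK. Qed.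

(** A relation with the derivative as second argument: closed forms are carried along and adjusted
    by [cderive_eq], and no derivative operator has to be computed. *)
Definition cderive f g : Prop := forall x,
  is_derive x 1 (re \o f) (re (g x)) /\ is_derive x 1 (im \o f) (im (g x)).

Lemma is_deriveD1 (f g : R -> R) x a b : is_derive x 1 f a -> is_derive x 1 g b ->
  is_derive x 1 (fun y => f y + g y) (a + b).
Proof. by move=> *; exact: is_deriveD. Qed.

Lemma is_deriveB1 (f g : R -> R) x a b : is_derive x 1 f a -> is_derive x 1 g b ->
  is_derive x 1 (fun y => f y - g y) (a - b).
Proof. by move=> *; exact: is_deriveB. Qed.

Lemma is_deriveN1 (f : R -> R) x a : is_derive x 1 f a ->
  is_derive x 1 (fun y => - f y) (- a).
Proof. by move=> *; exact: is_deriveN. Qed.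

Lemma is_deriveM1 (f g : R -> R) x a b : is_derive x 1 f a -> is_derive x 1 g b ->
  is_derive x 1 (fun y => f y * g y) (f x * b + a * g x).
Proof.
move=> df dg; have := is_deriveM df dg.
by rewrite /GRing.scale /= [g x * a]mulrC.
Qed.

Lemma is_derive_comp1 (f g : R -> R) x a b : is_derive (g x) 1 f a -> is_derive x 1 g b ->
  is_derive x 1 (fun y => f (g y)) (a * b).
Proof.
by move=> df dg; exact: is_derive1_comp.
Qed.

Lemma cderive_eq f g h : cderive f g -> g =1 h -> cderive f h.
Proof. by move=> df gh x; rewrite -gh. Qed.

Lemma cderive_eql f g h : cderive f g -> f =1 h -> cderive h g.
Proof. by move=> df /funext <-. Qed.

Lemma cderiveD f g f' g' : cderive f f' -> cderive g g' ->
  cderive (fun x => f x + g x) (fun x => f' x + g' x).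
Proof.
move=> df dg x; have [fr fi] := df x; have [gr gi] := dg x.
rewrite !reimE; split.
  by rewrite (_ : re \o _ = fun x => (re \o f) x + (re \o g) x);
    [exact: is_deriveD1|apply/funext => y /=; rewrite reimE].
by rewrite (_ : im \o _ = fun x => (im \o f) x + (im \o g) x);
    [exact: is_deriveD1|apply/funext => y /=; rewrite reimE].
Qed.

Lemma cderiveM f g f' g' : cderive f f' -> cderive g g' ->
  cderive (fun x => f x * g x) (fun x => f x * g' x + f' x * g x).
Proof.
move=> df dg x; have [fr fi] := df x; have [gr gi] := dg x.
split.
  rewrite (_ : re \o _ =
      fun x => (re \o f) x * (re \o g) x - (im \o f) x * (im \o g) x); last first.
    by apply/funext => y /=; rewrite reimE.
  apply: (is_derive_eq (is_deriveB1 (is_deriveM1 fr gr) (is_deriveM1 fi gi))).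
  by rewrite !reimE /=; ring.
rewrite (_ : im \o _ =
    fun x => (re \o f) x * (im \o g) x + (im \o f) x * (re \o g) x); last first.
  by apply/funext => y /=; rewrite reimE.
apply: (is_derive_eq (is_deriveD1 (is_deriveM1 fr gi) (is_deriveM1 fi gr))).
by rewrite !reimE /=; ring.
Qed.

Lemma cderive_cst z : cderive (fun _ => z) (fun _ => 0).
Proof. by move=> x; split; exact: is_derive_cst. Qed.

Lemma cderiveZ z f f' : cderive f f' -> cderive (fun x => z * f x) (fun x => z * f' x).
Proof.
move=> df; apply: cderive_eq; first exact: cderiveM (cderive_cst z) df.
by move=> x /=; rewrite mul0r addr0.
Qed.

Lemma cderive_real (q q' : R -> R) : (forall x, is_derive x 1 q (q' x)) ->
  cderive (fun x => (q x)%:C) (fun x => (q' x)%:C).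
Proof. by move=> dq x; split => //; exact: is_derive_cst. Qed.

Lemma cderive_expi (q q' : R -> R) : (forall x, is_derive x 1 q (q' x)) ->
  cderive (fun x => expi (q x)) (fun x => 'i * (q' x)%:C * expi (q x)).
Proof.
move=> dq x; rewrite !reimE /=; split.
  apply: (is_derive_eq (is_derive_comp1 (is_derive_cos _) (dq x))).
  by ring.
apply: (is_derive_eq (is_derive_comp1 (is_derive_sin _) (dq x))).
by ring.
Qed.

Lemma cderiveJ f f' : cderive f f' ->
  cderive (fun x => conjc (f x)) (fun x => conjc (f' x)).
Proof.
move=> df x; have [dr di] := df x; rewrite !reimE; split.
  by rewrite (_ : re \o _ = re \o f) //; apply/funext => y /=; rewrite reimE.
rewrite (_ : im \o _ = fun x => - (im \o f) x); first exact: is_deriveN1.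
by apply/funext => y /=; rewrite reimE.
Qed.

(** This serves as the uniqueness principle for the linear differential equations below: a solution
    times a solution of the opposite equation has derivative 0. *)
Lemma cderive0_cst f : cderive f (fun _ => 0) -> forall x y, f x = f y.
Proof.
move=> df x y; apply: complex_eq.
  by apply: (@is_derive_0_is_cst R (re \o f)) => t; have [] := df t.
by apply: (@is_derive_0_is_cst R (im \o f)) => t; have [] := df t.
Qed.

Lemma cderive_continuous f f' : cderive f f' ->
  continuous (re \o f) /\ continuous (im \o f).
Proof.
move=> df; split=> x; apply/differentiable_continuous/derivable1_diffP;
  by have [[] ? _ [] ? _] := df x.
Qed.

Lemma cderive_fun f f' : cderive f f' -> forall x,
  re (f' x) = (re \o f)^`()%classic x /\ im (f' x) = (im \o f)^`()%classic x.
Proof.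
by move=> df x; have [[? <-] [? <-]] := df x; rewrite !derive1E.
Qed.

End ComplexDerivative.

(** * Schwartz functions *)

Section Schwartz.
Context {R : realType}.
Implicit Types (f g : R -> R[i]) (t x y : R) (z w : R[i]).
Local Notation re := (@complex.Re R).
Local Notation im := (@complex.Im R).
Local Notation nc := (@ComplexField.Normc.normc R).

(** Decay of the function alone; the decay of its derivatives is recovered through
    [schwartz_coind]. *)
Definition rapid f : Prop :=
  forall m : nat, exists M : R, forall x, `|x| ^+ m * nc (f x) <= M.

Lemma norm_monomial m x z : `| x%:C ^+ m * z | = (`|x| ^+ m * nc z)%:C.
Proof. by rewrite normrM normrX !ncE nc_real rmorphM rmorphXn. Qed.

(** Closure under differentiation puts every iterated derivative back into [P], so smoothness
    follows by induction on the order and the decay of members bounds all seminorms. This replaces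
    Leibniz formulas: each later use only has to guess a class stable under one derivative. *)
Lemma schwartz_coind (P : (R -> R[i]) -> Prop) :
  (forall f, P f -> exists2 g, cderive f g & P g) ->
  (forall f, P f -> rapid f) ->
  forall f, P f -> schwartz f.
Proof.
move=> Pd Pb f Pf.
have Pn n : exists g, [/\ P g, re \o g = (re \o f)^`(n)%classic &
    im \o g = (im \o f)^`(n)%classic].
  elim: n => [|n [g [Pg gr gi]]]; first by exists f.
  have [h dh Ph] := Pd _ Pg; exists h; split=> //; rewrite derive1nS -?gr -?gi;
    by apply/funext => x /=; have [] := cderive_fun dh x.
split.
  move=> n x; have [g [Pg <- <-]] := Pn n; have [h dh _] := Pd _ Pg.
  by have [[? _] [? _]] := dh x.
move=> m n; have [g [Pg gr gi]] := Pn n; have [M hM] := Pb _ Pg m.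
exists M => x; rewrite (_ : Cderivn n f x = g x).
  by rewrite norm_monomial lecR.
by rewrite /Cderivn -gr -gi /=; case: (g x).
Qed.

Lemma schwartz_rapid f : schwartz f -> rapid f.
Proof.
move=> [_ bf] m; have [M hM] := bf m 0; exists M => x.
have := hM x; rewrite (_ : Cderivn 0 f x = f x); first by rewrite norm_monomial lecR.
by rewrite /Cderivn /=; case: (f x).
Qed.

Lemma schwartz_cderive f : schwartz f -> exists2 g, cderive f g & schwartz g.
Proof.
move=> [sf bf]; exists (Cderivn 1 f).
  by move=> x; have [d1 d2] := sf 0 x; split; split=> //=; rewrite derive1E.
have rE : re \o Cderivn 1 f = (re \o f)^`()%classic by apply/funext.
have iE : im \o Cderivn 1 f = (im \o f)^`()%classic by apply/funext.
split=> [n x|m n]; first by rewrite rE iE -!derive1Sn; exact: sf.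
have [M hM] := bf m n.+1; exists M => x; have := hM x.
by rewrite /Cderivn !derive1Sn rE iE.
Qed.

Lemma rapidD f g : rapid f -> rapid g -> rapid (fun x => f x + g x).
Proof.
move=> bf bg m; have [M hM] := bf m; have [N hN] := bg m; exists (M + N) => x.
apply: le_trans (lerD (hM x) (hN x)); rewrite -mulrDr.
by apply: ler_wpM2l (ncD _ _); rewrite exprn_ge0.
Qed.

Lemma rapidZ z f : rapid f -> rapid (fun x => z * f x).
Proof.
move=> bf m; have [M hM] := bf m; exists (nc z * M) => x.
by rewrite ncM mulrCA ler_wpM2l ?nc_ge0.
Qed.

Lemma rapidX f : rapid f -> rapid (fun x => x%:C * f x).
Proof.
move=> bf m; have [M hM] := bf m.+1; exists M => x.
by rewrite ncM nc_real mulrA -exprSr.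
Qed.

Lemma rapid_le f g : (forall x, nc (g x) <= nc (f x)) -> rapid f -> rapid g.
Proof.
move=> gf bf m; have [M hM] := bf m; exists M => x; apply: le_trans (hM x).
by apply: ler_wpM2l; rewrite ?exprn_ge0.
Qed.

Lemma schwartz_lin z f g : schwartz f -> schwartz g ->
  schwartz (fun x => z * f x + g x).
Proof.
move=> sf sg; pose P h := exists u v, [/\ schwartz u, schwartz v &
  h = fun x => z * u x + v x].
apply: (@schwartz_coind P); last by exists f, g.
  move=> _ [u [v [su sv ->]]]; have [u' du su'] := schwartz_cderive su.
  have [v' dv sv'] := schwartz_cderive sv.
  exists (fun x => z * u' x + v' x); last by exists u', v'.
  exact: cderiveD (cderiveZ _ du) dv.
move=> _ [u [v [su sv ->]]].
by apply: rapidD; [apply: rapidZ|]; exact: schwartz_rapid.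
Qed.

Lemma schwartz0 : schwartz (fun _ : R => 0 : R[i]).
Proof.
apply: (@schwartz_coind (fun h => h = fun=> 0)) => // _ ->.
  by exists (fun=> 0) => //; exact: cderive_cst.
by move=> m; exists 0 => x; rewrite ComplexField.Normc.normc0 mulr0.
Qed.

Lemma schwartzZ z f : schwartz f -> schwartz (fun x => z * f x).
Proof.
move=> sf; rewrite (_ : (fun x => z * f x) = (fun x => z * f x + 0)).
  exact: schwartz_lin schwartz0.
by apply/funext => x; rewrite addr0.
Qed.

Lemma schwartzD f g : schwartz f -> schwartz g -> schwartz (fun x => f x + g x).
Proof.
move=> sf sg; rewrite (_ : (fun x => f x + g x) = (fun x => 1 * f x + g x)).
  exact: schwartz_lin.
by apply/funext => x; rewrite mul1r.
Qed.

Lemma schwartzB f g : schwartz f -> schwartz g -> schwartz (fun x => f x - g x).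
Proof.
move=> sf sg; rewrite (_ : (fun x => f x - g x) = (fun x => -1 * g x + f x)).
  exact: schwartz_lin.
by apply/funext => x; rewrite mulN1r addrC.
Qed.

Lemma cderive_X f f' : cderive f f' ->
  cderive (fun x => x%:C * f x) (fun x => x%:C * f' x + f x).
Proof.
move=> df; apply: cderive_eq; first apply: cderiveM df.
  by apply: (cderive_real (q' := fun=> 1)) => x; exact: is_derive_id.
by move=> x /=; rewrite mul1r.
Qed.

(** Products [x u] alone are not stable under differentiation; the summand [v] absorbs the term [u]
    produced by the product rule. *)
Lemma schwartzX f : schwartz f -> schwartz (fun x => x%:C * f x).
Proof.
move=> sf; pose P h := exists u v, [/\ schwartz u, schwartz v &
  h = fun x => x%:C * u x + v x].
apply: (@schwartz_coind P).
- move=> _ [u [v [su sv ->]]]; have [u' du su'] := schwartz_cderive su.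
  have [v' dv sv'] := schwartz_cderive sv.
  exists (fun x => x%:C * u' x + (u x + v' x)).
    apply: cderive_eq; first exact: cderiveD (cderive_X du) dv.
    by move=> x /=; rewrite addrA.
  by exists u', (fun x => u x + v' x); split=> //; exact: schwartzD.
- move=> _ [u [v [su sv ->]]].
  by apply: rapidD; [apply: rapidX|]; exact: schwartz_rapid.
- exists f, (fun=> 0); split=> //; first exact: schwartz0.
  by apply/funext => x; rewrite addr0.
Qed.

Lemma is_derive_quadratic (a b c x : R) :
  is_derive x 1 (fun y => a * y ^+ 2 + b * y + c) (2 * a * x + b).
Proof.
rewrite (_ : (fun y => _) = horner (a%:P * 'X^2 + b%:P * 'X + c%:P)); last first.
  by apply/funext => y; rewrite !hornerE.
apply: (is_derive_eq (is_derive_poly _ _)).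
rewrite !derivD !derivM !derivC derivX !hornerE /=; ring.
Qed.

(* The derivative of [expi q * f] is [expi q * (f' + i q' f)], so the class of
   such products is closed under differentiation once [q'] is affine. *)
Lemma schwartz_chirp (a b c : R) f : schwartz f ->
  schwartz (fun x => f x * expi (a * x ^+ 2 + b * x + c)).
Proof.
move=> sf; pose P h := exists2 u, schwartz u &
  h = fun x => u x * expi (a * x ^+ 2 + b * x + c).
apply: (@schwartz_coind P); last by exists f.
  move=> _ [u su ->]; have [u' du su'] := schwartz_cderive su.
  pose v x := u' x + ('i * (2 * a)%:C * (x%:C * u x) + 'i * b%:C * u x).
  exists (fun x => v x * expi (a * x ^+ 2 + b * x + c)).
    apply: cderive_eq; first apply: (cderiveM du).
      apply: (@cderive_expi _ _ (fun x => 2 * a * x + b)) => x.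
      exact: is_derive_quadratic.
    by move=> x /=; rewrite /v; rewrite !rmorphD !rmorphM /=; ring.
  exists v => //; apply: schwartzD => //; apply: schwartz_lin; last exact: schwartzZ.
  exact: schwartzX.
move=> _ [u su ->]; apply: rapid_le (schwartz_rapid su) => x.
by rewrite ncM nc_expi mulr1.
Qed.

Lemma schwartzJ f : schwartz f -> schwartz (fun x => conjc (f x)).
Proof.
move=> sf; pose P h := exists2 u, schwartz u & h = fun x => conjc (u x).
apply: (@schwartz_coind P); last by exists f.
  move=> _ [u su ->]; have [u' du su'] := schwartz_cderive su.
  by exists (fun x => conjc (u' x)); [exact: cderiveJ|exists u'].
by move=> _ [u su ->]; apply: rapid_le (schwartz_rapid su) => x; rewrite ncJ.
Qed.

End Schwartz.

(** * Integration *)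

Section RealIntegrals.
Context {R : realType}.
Implicit Types (f g G : R -> R).
Local Notation leb := (@lebesgue_measure R).

Definition rint f : Prop := leb.-integrable setT (EFin \o f).

Lemma rint_measurable f : rint f -> measurable_fun setT f.
Proof. by move=> /measurable_int/measurable_EFinP. Qed.

Lemma rint_le f G : measurable_fun setT f -> (forall x, `|f x| <= G x) ->
  rint G -> rint f.
Proof.
move=> mf fG; apply: le_integrable => //; first exact/measurable_EFinP.
move=> x _ /=; rewrite lee_fin; apply: le_trans (fG x) _; exact: ler_norm.
Qed.

Lemma rintD f g : rint f -> rint g -> rint (fun x => f x + g x).
Proof. by move=> rf rg; exact: (integrableD measurableT rf rg). Qed.

Lemma rintZ c f : rint f -> rint (fun x => c * f x).
Proof. by move=> rf; exact: (integrableZl measurableT c rf). Qed.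

Lemma rint_norm f : rint f -> rint (fun x => `|f x|).
Proof. exact: integrable_norm. Qed.

Lemma rint_decay (C : R) : rint (fun x => C * (1 + x ^+ 2)^-1).
Proof.
apply: rintZ; have mf : measurable_fun setT (fun x : R => (1 + x ^+ 2)^-1).
  exact: continuous_measurable_fun (@continuous_oneDsqrV R).
apply/integrableP; split; first exact/measurable_EFinP.
have h x : 0 <= (1 + x ^+ 2)^-1 :> R by rewrite invr_ge0 addr_ge0 ?sqr_ge0.
under eq_integral => x _ do rewrite /= ger0_norm //.
rewrite ge0_symfun_integralT //.
- by rewrite -set_itvcy; have := integral0y_oneDsqr R; rewrite /oneDsqr => ->; rewrite -EFinM ltry.
- exact: continuous_oneDsqrV.
- by move=> x /=; rewrite sqrrN.
Qed.

Lemma RintegralDT f g : rint f -> rint g ->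
  \int[leb]_x (f x + g x) = \int[leb]_x f x + \int[leb]_x g x.
Proof. by move=> *; exact: RintegralD. Qed.

Lemma RintegralBT f g : rint f -> rint g ->
  \int[leb]_x (f x - g x) = \int[leb]_x f x - \int[leb]_x g x.
Proof. by move=> *; exact: RintegralB. Qed.

Lemma RintegralZT c f : rint f -> \int[leb]_x (c * f x) = c * \int[leb]_x f x.
Proof. by move=> *; exact: RintegralZl. Qed.

Lemma Rintegral_norm_le f G : rint f -> rint G -> (forall x, `|f x| <= G x) ->
  `|\int[leb]_x f x| <= \int[leb]_x G x.
Proof.
move=> rf rG fG; apply: le_trans (le_normr_Rintegral measurableT rf) _.
by apply: le_Rintegral => //; exact: rint_norm.
Qed.

Lemma Rintegral_dct (f_ : nat -> R -> R) f G :
  (forall n, measurable_fun setT (f_ n)) ->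
  (forall x, f_ n x @[n --> \oo] --> f x) -> rint G ->
  (forall n x, `|f_ n x| <= G x) ->
  rint f /\ \int[leb]_x f_ n x @[n --> \oo] --> \int[leb]_x f x.
Proof.
move=> mf_ cf rG fG.
have mf : measurable_fun setT f.
  by apply: (measurable_fun_cvg (h := f_)) => // x _; exact: cf.
have rf : rint f.
  apply: (rint_le mf _ rG) => x.
  by apply: (cvgr_to_le (cvg_norm (cf x))); near=> n; exact: fG.
split=> //; apply: fine_cvg; rewrite /Rintegral fineK; last first.
  exact: integrable_fin_num.
apply: (@dominated_cvg _ _ _ leb setT measurableT (fun n x => (f_ n x)%:E) _ (EFin \o G)) => //.
- by move=> n; apply/measurable_EFinP; exact: mf_.
- by move=> x _; apply: cvg_EFin; [exact: nearW|exact: cf].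
- by move=> n x _; rewrite lee_fin.
Unshelve. all: end_near. Qed.

(** The fundamental theorem on growing intervals leaves only boundary terms, which the decay of [F]
    kills. All later integrations by parts are instances of this. *)
Lemma Rintegral_derive0 (F g : R -> R) (C : R) :
  (forall x : R, is_derive x 1 F (g x)) -> continuous g -> rint g ->
  (forall x, `|F x| <= C * (1 + x ^+ 2)^-1) -> \int[leb]_x g x = 0.
Proof.
move=> dF cg rg FC.
have cF : continuous F.
  by move=> x; apply/differentiable_continuous/derivable1_diffP; have [] := dF x.
pose I n := `[- n%:R, n%:R]%classic : set R.
pose gn n := g \_ (I n).
(* The shift to [n.+1] keeps the interval nondegenerate, as the fundamental theorem requires. *)
have gnI n : \int[leb]_x gn n.+1 x = F n.+1%:R - F (- n.+1%:R).
  rewrite /gn -Rintegral_mkcond /Rintegral (@continuous_FTC2 _ _ F) //.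
  - by rewrite (lt_trans (y := 0)) ?oppr_lt0 ?ltr0n.
  - exact: continuous_subspaceT.
  - split; first by move=> x _; have [] := dF x.
      exact: cvg_at_right_filter (cF _).
    exact: cvg_at_left_filter (cF _).
  - by move=> x _; rewrite derive1E; have [] := dF x.
have [_ lim] : rint g /\ \int[leb]_x gn n.+1 x @[n --> \oo] --> \int[leb]_x g x.
  apply: (@Rintegral_dct _ _ (fun x => `|g x|)); last 1 first.
  - by move=> n x; rewrite /gn patchE; case: ifP => // _; rewrite normr0.
  - move=> n; apply/(measurable_restrictT _ _).1; first exact: measurable_itv.
    by apply: measurable_funTS; exact: rint_measurable.
  - move=> x; apply: cvg_near_cst; near=> n.
    rewrite /gn patchE ifT // inE /I /= in_itv /= -ler_norml.
    have : `|x| <= n%:R by near: n; exact: nbhs_infty_ger.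
    by move=> h; apply: le_trans h _; rewrite ler_nat.
  - exact: rint_norm.
have lim0 : \int[leb]_x gn n.+1 x @[n --> \oo] --> (0 : R).
  apply: norm_cvg0.
  apply: (@squeeze_cvgr _ _ _ _ (fun=> 0) (fun n => 2 * C * n.+1%:R^-1)).
  - near=> n; rewrite normr_ge0 /= gnI; apply: le_trans (ler_normB _ _) _.
    apply: le_trans (lerD (FC _) (FC _)) _; rewrite sqrrN -mulr2n -mulrnAl -mulr_natl.
    apply: ler_wpM2l; last first.
      rewrite lef_pV2; first last; [by rewrite posrE ltr0n|by rewrite posrE ltr_pwDl ?sqr_ge0 ?ltr01|].
      rewrite -natrX -[1 + _]/(1%:R + _) -natrD ler_nat; lia.
    rewrite mulr_ge0 //; have := le_trans (normr_ge0 _) (FC 0).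
    by rewrite expr0n /= addr0 invr1 mulr1.
  - exact: cvg_cst.
  - rewrite -[X in _ --> X](mulr0 (2 * C)); apply: cvgM; first exact: cvg_cst.
    exact: cvg_harmonic.
by have := cvg_unique _ lim lim0; apply.
Unshelve. all: end_near. Qed.

End RealIntegrals.

(** * Complex integrals: majorants, limits, differentiation under the integral *)

Section ComplexIntegrals.
Context {R : realType}.
Implicit Types (f g : R -> R[i]) (G : R -> R) (k t x y : R) (z w : R[i]).
Local Notation re := (@complex.Re R).
Local Notation im := (@complex.Im R).
Local Notation nc := (@ComplexField.Normc.normc R).
Local Notation leb := (@lebesgue_measure R).

Definition cmeas f : Prop :=
  measurable_fun setT (re \o f) /\ measurable_fun setT (im \o f).

Definition Cint f : Prop := rint (re \o f) /\ rint (im \o f).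

Lemma cmeasD f g : cmeas f -> cmeas g -> cmeas (fun x => f x + g x).
Proof.
move=> [fr fi] [gr gi]; split.
  rewrite (_ : re \o _ = (re \o f) \+ (re \o g)); first exact: measurable_funD.
  by apply/funext => x /=; rewrite reD.
rewrite (_ : im \o _ = (im \o f) \+ (im \o g)); first exact: measurable_funD.
by apply/funext => x /=; rewrite imD.
Qed.

Lemma cmeasM f g : cmeas f -> cmeas g -> cmeas (fun x => f x * g x).
Proof.
move=> [fr fi] [gr gi]; split.
  rewrite (_ : re \o _ = ((re \o f) \* (re \o g)) \- ((im \o f) \* (im \o g))).
    by apply: measurable_funB; apply: measurable_funM.
  by apply/funext => x /=; rewrite reM.
rewrite (_ : im \o _ = ((re \o f) \* (im \o g)) \+ ((im \o f) \* (re \o g))).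
  by apply: measurable_funD; apply: measurable_funM.
by apply/funext => x /=; rewrite imM.
Qed.

Lemma cmeas_cst z : cmeas (fun=> z).
Proof. by split; exact: measurable_cst. Qed.

Lemma cmeasJ f : cmeas f -> cmeas (fun x => conjc (f x)).
Proof.
move=> [fr fi]; split.
  by rewrite (_ : re \o _ = re \o f) //; apply/funext => x /=; rewrite reJ.
rewrite (_ : im \o _ = \- (im \o f)); first exact: measurable_funN.
by apply/funext => x /=; rewrite imJ.
Qed.

Lemma cmeas_expi (q : R -> R) : measurable_fun setT q -> cmeas (fun x => expi (q x)).
Proof.
move=> mq; split.
  apply: (measurableT_comp (f := @cos R)) mq.
  exact: continuous_measurable_fun (@continuous_cos R).
apply: (measurableT_comp (f := @sin R)) mq.
exact: continuous_measurable_fun (@continuous_sin R).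
Qed.

Lemma Cint_cmeas f : Cint f -> cmeas f.
Proof. by move=> [? ?]; split; exact: rint_measurable. Qed.

Lemma Cint_le f G : cmeas f -> (forall x, nc (f x) <= G x) -> rint G -> Cint f.
Proof.
move=> [mr mi] fG rG; split; apply: (rint_le _ _ rG) => // x /=;
  by apply: le_trans (fG x); rewrite ?le_re_nc ?le_im_nc.
Qed.

Lemma Cint_majorant f : Cint f -> exists2 G, rint G & forall x, nc (f x) <= G x.
Proof.
move=> [fr fi]; exists (fun x => `|re (f x)| + `|im (f x)|).
  by apply: rintD; exact: rint_norm.
by move=> x; exact: nc_le_reim.
Qed.

Lemma CintM_bounded f g (M : R) : Cint f -> cmeas g -> (forall x, nc (g x) <= M) ->
  Cint (fun x => f x * g x).
Proof.
move=> fi mg gM; have [G rG fG] := Cint_majorant fi.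
apply: (@Cint_le _ (fun x => M * G x)); last exact: rintZ.
  by apply: cmeasM => //; exact: Cint_cmeas.
by move=> x; rewrite ncM mulrC ler_pM ?nc_ge0.
Qed.

Lemma CintZ z f : Cint f -> Cint (fun x => z * f x).
Proof.
move=> fi; rewrite (_ : (fun x => _) = fun x => f x * z).
  by apply: (CintM_bounded fi (cmeas_cst z)).
by apply/funext => x; rewrite mulrC.
Qed.

Lemma CintegralD f g : Cint f -> Cint g ->
  Cintegral (fun x => f x + g x) = Cintegral f + Cintegral g.
Proof.
move=> [fr fi] [gr gi]; apply: complex_eq; rewrite ?reD ?imD /=.
  by rewrite -RintegralDT //; apply: eq_Rintegral => x _; rewrite reD.
by rewrite -RintegralDT //; apply: eq_Rintegral => x _; rewrite imD.
Qed.

Lemma CintegralZ z f : Cint f -> Cintegral (fun x => z * f x) = z * Cintegral f.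
Proof.
move=> [fr fi]; apply: complex_eq; rewrite ?reM ?imM /=.
  rewrite -!RintegralZT // -RintegralBT; [|exact: rintZ..].
  by apply: eq_Rintegral => x _; rewrite reM.
rewrite -!RintegralZT // -RintegralDT; [|exact: rintZ..].
by apply: eq_Rintegral => x _; rewrite imM.
Qed.

Lemma CintegralB f g : Cint f -> Cint g ->
  Cintegral (fun x => f x - g x) = Cintegral f - Cintegral g.
Proof.
move=> fi gi; rewrite -mulN1r -CintegralZ // -CintegralD //; last exact: CintZ.
by congr Cintegral; apply/funext => x; rewrite mulN1r.
Qed.

Lemma CintegralJ f : Cint f ->
  Cintegral (fun x => conjc (f x)) = conjc (Cintegral f).
Proof.
move=> [fr fi]; apply: complex_eq; rewrite ?reJ ?imJ /=.
  by apply: eq_Rintegral => x _; rewrite reJ.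
rewrite -mulN1r -RintegralZT //.
by apply: eq_Rintegral => x _; rewrite imJ mulN1r.
Qed.

(** The factor 2 comes from bounding the real and imaginary parts separately; it is harmless where
    only boundedness or convergence to 0 is at stake. *)
Lemma nc_Cintegral_le f G : cmeas f -> rint G -> (forall x, nc (f x) <= G x) ->
  nc (Cintegral f) <= 2 * \int[leb]_x G x.
Proof.
move=> mf rG fG; have [fr fi] := Cint_le mf fG rG.
apply: le_trans (nc_le_reim _) _; rewrite mulr2n mulrDl mul1r.
by apply: lerD; apply: Rintegral_norm_le => // x /=; apply: le_trans (fG x);
  rewrite ?le_re_nc ?le_im_nc.
Qed.

Definition ccvg (u : nat -> R[i]) z : Prop :=
  re (u n) @[n --> \oo] --> re z /\ im (u n) @[n --> \oo] --> im z.

Lemma ccvg_unique u z w : ccvg u z -> ccvg u w -> z = w.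
Proof.
move=> [zr zi] [wr wi]; apply: complex_eq.
  exact: cvg_unique zr wr.
exact: cvg_unique zi wi.
Qed.

Lemma ccvg_cst z : ccvg (fun=> z) z.
Proof. by split; exact: cvg_cst. Qed.

Lemma ccvg_real (a : nat -> R) (l : R) : a n @[n --> \oo] --> l ->
  ccvg (fun n => (a n)%:C) l%:C.
Proof. by move=> al; split => //=; exact: cvg_cst. Qed.

Lemma ccvgM u v z w : ccvg u z -> ccvg v w -> ccvg (fun n => u n * v n) (z * w).
Proof.
move=> [ur ui] [vr vi]; split.
  under eq_fun do rewrite reM.
  by rewrite reM; apply: cvgB; apply: cvgM.
under eq_fun do rewrite imM.
by rewrite imM; apply: cvgD; apply: cvgM.
Qed.

Lemma ccvg_expi (a : nat -> R) (l : R) : a n @[n --> \oo] --> l ->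
  ccvg (fun n => expi (a n)) (expi l).
Proof.
move=> al; split=> /=.
  exact: (cvg_comp _ _ al (@continuous_cos R l)).
exact: (cvg_comp _ _ al (@continuous_sin R l)).
Qed.

Lemma ccvg_Cintegral (f_ : nat -> R -> R[i]) f G :
  (forall n, cmeas (f_ n)) -> (forall x, ccvg (f_ ^~ x) (f x)) -> rint G ->
  (forall n x, nc (f_ n x) <= G x) ->
  ccvg (fun n => Cintegral (f_ n)) (Cintegral f).
Proof.
move=> mf cf rG fG; split.
  apply: (proj2 (Rintegral_dct (f := re \o f) (G := G) _ _ rG _)).
  - by move=> n; have [] := mf n.
  - by move=> x; have [] := cf x.
  - by move=> n x; apply: le_trans (fG n x); exact: le_re_nc.
apply: (proj2 (Rintegral_dct (f := im \o f) (G := G) _ _ rG _)).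
- by move=> n; have [] := mf n.
- by move=> x; have [] := cf x.
- by move=> n x; apply: le_trans (fG n x); exact: le_im_nc.
Qed.

Lemma cderive_cmeas f f' : cderive f f' -> cmeas f.
Proof.
by move=> /cderive_continuous[cr ci]; split; exact: continuous_measurable_fun.
Qed.

Lemma schwartz_cmeas f : schwartz f -> cmeas f.
Proof. by move=> /schwartz_cderive[f' /cderive_cmeas]. Qed.

Lemma rapid_decay f : rapid f ->
  exists2 C, 0 <= C & forall x, nc (f x) <= C * (1 + x ^+ 2)^-1.
Proof.
(* The bounds for the powers 0 and 2 add up to a bound for [(1 + x^2) |f|]. *)
move=> bf; have [M hM] := bf 0; have [N hN] := bf 2; exists (M + N).
  by apply: addr_ge0; [apply: le_trans (hM 0)|apply: le_trans (hN 0)];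
    rewrite mulr_ge0 ?nc_ge0 ?exprn_ge0.
move=> x; rewrite ler_pdivlMr ?ltr_pwDl ?sqr_ge0 ?ltr01 //.
apply: le_trans (lerD (hM x) (hN x)).
by rewrite real_normK ?num_real // expr0 mul1r mulrDr mulr1 lerD2l mulrC.
Qed.

Lemma rapid_Cint f : cmeas f -> rapid f -> Cint f.
Proof.
move=> mf /rapid_decay[C _ fC]; exact: Cint_le mf fC (rint_decay C).
Qed.

Lemma schwartz_Cint f : schwartz f -> Cint f.
Proof. by move=> sf; apply: rapid_Cint (schwartz_cmeas sf) (schwartz_rapid sf). Qed.

Lemma Cintegral_derive0 f f' : cderive f f' -> schwartz f -> schwartz f' ->
  Cintegral f' = 0.
Proof.
move=> df sf sf'; have [C _ fC] := rapid_decay (schwartz_rapid sf).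
have [f'' df' _] := schwartz_cderive sf'; have [cr ci] := cderive_continuous df'.
have [ir ii] := schwartz_Cint sf'.
apply: complex_eq.
  apply: (@Rintegral_derive0 _ (re \o f) _ C) => // x; first by have [] := df x.
  exact: le_trans (le_re_nc _) (fC x).
apply: (@Rintegral_derive0 _ (im \o f) _ C) => // x; first by have [] := df x.
exact: le_trans (le_im_nc _) (fC x).
Qed.

Lemma is_derive_Rintegral (F F' : R -> R -> R) G :
  (forall t, rint (F t)) -> (forall y t, is_derive t 1 (F ^~ y) (F' t y)) ->
  rint G -> (forall t y, `|F' t y| <= G y) ->
  forall t, is_derive t 1 (fun t => \int[leb]_y F t y) (\int[leb]_y F' t y).
Proof.
move=> iF dF iG F'G t.
have d1E s y : partial1of2 F s y = F' s y.
  by rewrite partial1of2E; have [] := dF y s.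
have tI : `]t - 1, t + 1[%classic t by rewrite /= in_itv /= ltrDl ltrBlDl ltrDr ltr01.
have G0 y : 0 <= G y by apply: le_trans (F'G t y).
have dF1 s y : derivable (F ^~ y) s 1 by have [] := dF y s.
have h1 : forall s y, `]t - 1, t + 1[%classic s -> setT y -> derivable (F ^~ y) s 1.
  by move=> s y _ _; exact: dF1.
have h2 : forall s y, `]t - 1, t + 1[%classic s -> setT y ->
    `|partial1of2 F s y| <= G y by move=> s y _ _; rewrite d1E.
have h0 : forall s, `]t - 1, t + 1[%classic s -> leb.-integrable setT (EFin \o F s).
  by move=> s _; exact: iF.
apply: DeriveDef.
  exact: (@derivable_under_integral R _ _ leb F setT measurableT t _ _ tI h0 h1 G G0 iG h2).
rewrite -derive1E.
rewrite (@differentiation_under_integral R _ _ leb F setT measurableT t _ _ tI h0 h1 G G0 iG h2).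
by apply: eq_Rintegral => y _; rewrite d1E.
Qed.

Lemma cderive_Cintegral (F F' : R -> R -> R[i]) G :
  (forall t, Cint (F t)) -> (forall y, cderive (F ^~ y) (F' ^~ y)) ->
  rint G -> (forall t y, nc (F' t y) <= G y) ->
  cderive (fun t => Cintegral (F t)) (fun t => Cintegral (F' t)).
Proof.
move=> iF dF iG F'G t; split.
  apply: (@is_derive_Rintegral (fun t => re \o F t) (fun t => re \o F' t) G) => //.
  - by move=> s; have [] := iF s.
  - by move=> y s; have [] := dF y s.
  - by move=> s y; exact: le_trans (le_re_nc _) (F'G s y).
apply: (@is_derive_Rintegral (fun t => im \o F t) (fun t => im \o F' t) G) => //.
- by move=> s; have [] := iF s.
- by move=> y s; have [] := dF y s.
- by move=> s y; exact: le_trans (le_im_nc _) (F'G s y).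
Qed.

(** The general phase [q] lets one statement cover differentiation in the frequency ([q] linear) and
    in the chirp parameter of a Gaussian ([q y = - y^2]). *)
Lemma cderive_oscillatory f (q : R -> R) : measurable_fun setT q -> Cint f ->
  Cint (fun y => (q y)%:C * f y) ->
  cderive (fun t => Cintegral (fun y => f y * expi (t * q y)))
    (fun t => Cintegral (fun y => 'i * ((q y)%:C * f y) * expi (t * q y))).
Proof.
move=> mq fi qfi; have [G rG qfG] := Cint_majorant (CintZ 'i qfi).
apply: (cderive_Cintegral _ _ rG).
- move=> t; apply: (@CintM_bounded _ _ 1 fi) => [|x]; last by rewrite nc_expi.
  by apply: cmeas_expi; apply: measurable_funM => //; exact: measurable_cst.
- move=> y; apply: cderive_eq.
    apply: cderiveZ; apply: (@cderive_expi _ _ (fun=> q y)) => t.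
    apply: (is_derive_eq (is_deriveM1 (is_derive_id t 1) (is_derive_cst (q y) t 1))).
    by rewrite mulr0 add0r mul1r.
  by move=> t /=; ring.
- by move=> t y; rewrite ncM nc_expi mulr1.
Qed.

End ComplexIntegrals.

(** * Fourier transform *)

Section FourierTransform.
Context {R : realType}.
Implicit Types (f g h : R -> R[i]) (G : R -> R) (k t x y : R) (z w : R[i]).
Local Notation re := (@complex.Re R).
Local Notation im := (@complex.Im R).
Local Notation nc := (@ComplexField.Normc.normc R).
Local Notation leb := (@lebesgue_measure R).

Definition FT k f t : R[i] := Cintegral (fun x => f x * expi (k * t * x)).

Lemma schwartz_wave k f : schwartz f -> schwartz (fun x => f x * expi (k * x)).
Proof.
move=> sf; have := schwartz_chirp 0 k 0 sf; congr schwartz.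
by apply/funext => x; rewrite mul0r add0r addr0.
Qed.

Lemma FT_lin k z f g t : schwartz f -> schwartz g ->
  FT k (fun x => z * f x + g x) t = z * FT k f t + FT k g t.
Proof.
move=> sf sg; have [wf wg] := (schwartz_wave (k * t) sf, schwartz_wave (k * t) sg).
rewrite /FT -CintegralZ; last exact: schwartz_Cint.
rewrite -CintegralD; [|apply: CintZ; exact: schwartz_Cint|exact: schwartz_Cint].
by congr Cintegral; apply/funext => x; ring.
Qed.

Lemma FT_cderive k f : schwartz f ->
  cderive (FT k f) (FT k (fun x => 'i * k%:C * (x%:C * f x))).
Proof.
move=> sf; have mq : measurable_fun setT (fun x => k * x).
  exact: mulrl_measurable.
have := cderive_oscillatory mq (schwartz_Cint sf); rewrite /FT.
have -> : (fun y => (k * y)%:C * f y) = (fun y => k%:C * (y%:C * f y)).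
  by apply/funext => y; rewrite rmorphM mulrA.
move=> /(_ (CintZ _ (schwartz_Cint (schwartzX sf)))) d.
apply: cderive_eql.
  by apply: cderive_eq; [exact: d|move=> t; congr Cintegral; apply/funext => y;
    rewrite [k * t]mulrC -mulrA rmorphM !mulrA].
by move=> t; congr Cintegral; apply/funext => y; rewrite [k * t]mulrC mulrA.
Qed.

(** Integration by parts: the derivative of [f x * expi (k * t * x)] has integral 0. *)
Lemma FT_of_cderive k f f' t : cderive f f' -> schwartz f -> schwartz f' ->
  FT k f' t = - ('i * (k * t)%:C * FT k f t).
Proof.
move=> df sf sf'; apply/eqP; rewrite -addr_eq0; apply/eqP; rewrite /FT -CintegralZ.
  rewrite -CintegralD; first apply: (@Cintegral_derive0 _ (fun x => f x * expi (k * t * x))).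
  - apply: cderive_eq.
      apply: (cderiveM df); apply: (@cderive_expi _ _ (fun=> k * t)) => x.
      apply: (is_derive_eq (is_deriveM1 (is_derive_cst (k * t) x 1) (is_derive_id x 1))).
      by rewrite mulr1 mul0r addr0.
    by move=> x /=; ring.
  - exact: schwartz_wave.
  - apply: schwartzD; first exact: schwartz_wave.
    by apply: schwartzZ; exact: schwartz_wave.
  - by apply: schwartz_Cint; exact: schwartz_wave.
  - by apply: CintZ; apply: schwartz_Cint; exact: schwartz_wave.
by apply: schwartz_Cint; exact: schwartz_wave.
Qed.

Lemma FT_bounded k f : schwartz f -> exists M, forall t, nc (FT k f t) <= M.
Proof.
move=> sf; have [G rG fG] := Cint_majorant (schwartz_Cint sf).
exists (2 * \int[leb]_x G x) => t; apply: nc_Cintegral_le => //.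
  exact/schwartz_cmeas/schwartz_wave.
by move=> x; rewrite ncM nc_expi mulr1.
Qed.

(** Each power of the frequency is traded for a derivative of [f], at the cost of a factor
    [1 / |k|]. *)
Lemma FT_rapid k f : k != 0 -> schwartz f -> rapid (FT k f).
Proof.
move=> k0 sf m; elim: m f sf => [|m IH] f sf.
  by have [M hM] := FT_bounded k sf; exists M => t; rewrite expr0 mul1r.
have [f' df sf'] := schwartz_cderive sf; have [M hM] := IH _ sf'.
exists (`|k|^-1 * M) => t; rewrite ler_pdivlMl ?normr_gt0 //.
apply: le_trans (hM t); rewrite (FT_of_cderive _ _ df sf sf') ncN !ncM nc_real.
rewrite [nc 'i](_ : _ = 1) /=; last by rewrite expr0n expr1n add0r sqrtr1.
by rewrite mul1r normrM exprSr le_eqVlt; apply/orP; left; apply/eqP; ring.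
Qed.

Lemma schwartz_FT k f : k != 0 -> schwartz f -> schwartz (FT k f).
Proof.
move=> k0 sf; apply: (@schwartz_coind _ (fun h => exists2 u, schwartz u & h = FT k u)).
- move=> _ [u su ->]; pose v x := 'i * k%:C * (x%:C * u x).
  exists (FT k v); first exact: FT_cderive.
  by exists v => //; apply: schwartzZ; exact: schwartzX.
- by move=> _ [u su ->]; exact: FT_rapid.
- by exists f.
Qed.

Definition cint2 (K : R * R -> R) : Prop := (leb \x leb)%E.-integrable setT (EFin \o K).

Lemma Rintegral_swap (K : R * R -> R) : cint2 K ->
  (forall x, rint (fun y => K (x, y))) -> (forall y, rint (fun x => K (x, y))) ->
  \int[leb]_x (\int[leb]_y K (x, y)) = \int[leb]_y (\int[leb]_x K (x, y)).
Proof.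
move=> K2 Kx Ky; have := Fubini K2 => /(congr1 fine).
rewrite /Rintegral => E; transitivity (fine (\int[leb]_x \int[leb]_y (K (x, y))%:E)%E).
  congr fine; apply: eq_integral => x _; rewrite fineK //.
  exact: (integrable_fin_num measurableT (Kx x)).
rewrite [LHS]E; congr fine; apply: eq_integral => y _; rewrite fineK //.
exact: (integrable_fin_num measurableT (Ky y)).
Qed.

Lemma cint2_le (K : R * R -> R) (G1 G2 : R -> R) : measurable_fun setT K ->
  (forall x, 0 <= G1 x) -> (forall x, 0 <= G2 x) -> rint G1 -> rint G2 ->
  (forall p, `|K p| <= G1 p.1 * G2 p.2) -> cint2 K.
Proof.
move=> mK G10 G20 r1 r2 KG.
have mE : measurable_fun setT (EFin \o K) by exact/measurable_EFinP.
apply: (proj2 (integrable12ltyP leb leb mE)) => /=.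
have m1 := rint_measurable r1; have m2 := rint_measurable r2.
have mabs : measurable_fun setT (fun p : R * R => `|(K p)%:E|%E).
  by apply: measurableT_comp.
have mG : measurable_fun setT (fun p : R * R => (G1 p.1 * G2 p.2)%:E).
  apply/measurable_EFinP; apply: measurable_funM.
    exact: (measurableT_comp m1 measurable_fst).
  exact: (measurableT_comp m2 measurable_snd).
have G0 (p : R * R) : (0 <= (G1 p.1 * G2 p.2)%:E)%E by rewrite lee_fin mulr_ge0.
apply: (@le_lt_trans _ _ (\int[leb]_x \int[leb]_y (G1 x * G2 y)%:E)%E).
  apply: ge0_le_integral => //.
  - by move=> x _; exact: integral_ge0.
  - exact: (measurable_fun_fubini_tonelli_F (m2 := leb) _ mabs (fun p => abse_ge0 _)).
  - exact: (measurable_fun_fubini_tonelli_F (m2 := leb) _ mG G0).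
  - move=> x _; apply: ge0_le_integral => //.
    + by apply: (measurableT_comp mabs); exact: pair1_measurable.
    + by apply/measurable_EFinP; exact: measurable_funM.
    + by move=> y _; rewrite lee_fin; exact: (KG (x, y)).
under eq_integral => x _.
  rewrite (_ : (\int[leb]_y (G1 x * G2 y)%:E)%E = (G1 x)%:E * (\int[leb]_y G2 y)%:E)%E; last first.
    under eq_integral do rewrite EFinM.
    rewrite integralZl // /Rintegral fineK //; exact: integrable_fin_num.
  over.
rewrite integralZr // -(fineK (integrable_fin_num _ r1)) // -EFinM; exact: ltry.
Qed.

(** The kernel is symmetric in its two variables, so exchanging the integrals moves the transform
    from one factor to the other. The decay of [f] and [h] gives a product majorant, hence joint
    integrability. *)
Lemma FT_fubini k f h : schwartz f -> schwartz h ->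
  Cintegral (fun y => FT k f y * h y) = Cintegral (fun x => f x * FT k h x).
Proof.
move=> sf sh; pose K p : R[i] := f p.2 * h p.1 * expi (k * p.1 * p.2).
have [C C0 fC] := rapid_decay (schwartz_rapid sf).
have [D D0 hD] := rapid_decay (schwartz_rapid sh).
have [mfr mfi] := schwartz_cmeas sf; have [mhr mhi] := schwartz_cmeas sh.
pose G1 x := D * (1 + x ^+ 2)^-1; pose G2 x := C * (1 + x ^+ 2)^-1.
have dec0 (A : R) x : 0 <= A -> 0 <= A * (1 + x ^+ 2)^-1.
  by move=> A0; rewrite mulr_ge0 ?invr_ge0 ?addr_ge0 ?sqr_ge0.
have KG p : nc (K p) <= G1 p.1 * G2 p.2.
  by rewrite /K !ncM nc_expi mulr1 mulrC ler_pM ?nc_ge0.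
have mph : measurable_fun setT (fun p : R * R => k * p.1 * p.2).
  apply: measurable_funM; last exact: measurable_snd.
  by apply: measurable_funM => //; exact: measurable_fst.
have mcos : measurable_fun setT (fun p : R * R => cos (k * p.1 * p.2)).
  by apply: (measurableT_comp (f := @cos R)) mph; exact: continuous_measurable_fun (@continuous_cos R).
have msin : measurable_fun setT (fun p : R * R => sin (k * p.1 * p.2)).
  by apply: (measurableT_comp (f := @sin R)) mph; exact: continuous_measurable_fun (@continuous_sin R).
have [m1 [m2 [m3 m4]]] : measurable_fun setT (fun p : R * R => re (f p.2)) /\
    measurable_fun setT (fun p : R * R => im (f p.2)) /\
    measurable_fun setT (fun p : R * R => re (h p.1)) /\
    measurable_fun setT (fun p : R * R => im (h p.1)).
  split; first exact: (measurableT_comp mfr measurable_snd).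
  split; first exact: (measurableT_comp mfi measurable_snd).
  split; first exact: (measurableT_comp mhr measurable_fst).
  exact: (measurableT_comp mhi measurable_fst).
have Kr : cint2 (fun p => re (K p)).
  apply: (@cint2_le _ G1 G2); rewrite /G1 /G2; try exact: rint_decay.
  - rewrite /K (_ : (fun p : R * R => _) = fun p : R * R =>
      (re (f p.2) * re (h p.1) - im (f p.2) * im (h p.1)) * cos (k * p.1 * p.2) -
      (re (f p.2) * im (h p.1) + im (f p.2) * re (h p.1)) * sin (k * p.1 * p.2)).
      apply: measurable_funB; apply: measurable_funM => //.
        by apply: measurable_funB; apply: measurable_funM.
      by apply: measurable_funD; apply: measurable_funM.
    by apply/funext => p; rewrite !reimE.
  - by move=> x; exact: dec0.
  - by move=> x; exact: dec0.
  - by move=> p; apply: le_trans (KG p); exact: le_re_nc.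
have Ki : cint2 (fun p => im (K p)).
  apply: (@cint2_le _ G1 G2); rewrite /G1 /G2; try exact: rint_decay.
  - rewrite /K (_ : (fun p : R * R => _) = fun p : R * R =>
      (re (f p.2) * re (h p.1) - im (f p.2) * im (h p.1)) * sin (k * p.1 * p.2) +
      (re (f p.2) * im (h p.1) + im (f p.2) * re (h p.1)) * cos (k * p.1 * p.2)).
      apply: measurable_funD; apply: measurable_funM => //.
        by apply: measurable_funB; apply: measurable_funM.
      by apply: measurable_funD; apply: measurable_funM.
    by apply/funext => p; rewrite !reimE.
  - by move=> x; exact: dec0.
  - by move=> x; exact: dec0.
  - by move=> p; apply: le_trans (KG p); exact: le_im_nc.
have K1 y : Cint (fun x => K (y, x)).
  rewrite /K /= (_ : (fun x => _) = fun x => h y * (f x * expi (k * y * x))).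
    by apply: CintZ; apply/schwartz_Cint/schwartz_wave.
  by apply/funext => x; ring.
have K2 x : Cint (fun y => K (y, x)).
  rewrite /K /= (_ : (fun y => _) = fun y => f x * (h y * expi (k * x * y))).
    by apply: CintZ; apply/schwartz_Cint/schwartz_wave.
  by apply/funext => y; rewrite -mulrA [k * y * x]mulrAC.
transitivity (Cintegral (fun y => Cintegral (fun x => K (y, x)))).
  congr Cintegral; apply/funext => y; rewrite mulrC -CintegralZ; last first.
    exact/schwartz_Cint/schwartz_wave.
  by congr Cintegral; apply/funext => x; rewrite /K /=; ring.
transitivity (Cintegral (fun x => Cintegral (fun y => K (y, x)))); last first.
  congr Cintegral; apply/funext => x; rewrite -CintegralZ; last first.
    exact/schwartz_Cint/schwartz_wave.
  by congr Cintegral; apply/funext => y; rewrite /K /= -mulrA [k * y * x]mulrAC.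
apply: complex_eq => /=.
  apply: (@Rintegral_swap (fun p => re (K p))) => //.
    by move=> y; have [] := K1 y.
  by move=> x; have [] := K2 x.
apply: (@Rintegral_swap (fun p => im (K p))) => //.
  by move=> y; have [] := K1 y.
by move=> x; have [] := K2 x.
Qed.

End FourierTransform.

(** * Fourier transform of the complex Gaussian *)

Section Gaussians.
Context {R : realType}.
Implicit Types (f g h : R -> R[i]) (a b k t s x y : R) (z w : R[i]) (p q : {poly R}).
Local Notation re := (@complex.Re R).
Local Notation im := (@complex.Im R).
Local Notation nc := (@ComplexField.Normc.normc R).
Local Notation leb := (@lebesgue_measure R).

Lemma expn_le_expR n : exists2 M, 0 <= M & forall y : R, 0 <= y -> y ^+ n <= M * expR y.
Proof.
case: n => [|n].
  by exists 1 => // y y0; rewrite mul1r expr0 -expR0 ler_expR.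
(* With [N] the exponent, this is [y / N <= e^(y / N)] raised to the power [N]. *)
exists (n.+1%:R ^+ n.+1); first by rewrite exprn_ge0.
move=> y y0; rewrite -ler_pdivrMl ?exprn_gt0 ?ltr0n // -exprVn -exprMn.
rewrite -[y in expR y](mulVKf (_ : n.+1%:R != 0)) ?pnatr_eq0 // expRM_natl.
rewrite lerXn2r ?nnegrE ?expR_ge0 ?mulr_ge0 ?invr_ge0 //.
by apply: le_trans (expR_ge1Dx _); rewrite lerDr.
Qed.

(** The induction on [q] keeps [m] general: for [q X + c] the extra factor [x] is passed to the
    power [m + 1], and only the constant [c] is left to estimate. *)
Lemma horner_gauss_bounded q a m : 0 < a ->
  exists M, forall x, `|x| ^+ m * `|q.[x]| * expR (- (a * x ^+ 2)) <= M.
Proof.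
move=> a0; elim/poly_ind: q m => [|q c IH] m.
  by exists 0 => x; rewrite horner0 normr0 mulr0 mul0r.
have [M hM] := IH m.+1; have [N N0 hN] := expn_le_expR m.
exists (M + `|c| * (1 + N / a ^+ m)) => x; rewrite hornerMXaddC.
set E := expR _; have E0 : 0 <= E by exact: expR_ge0.
have E1 : E <= 1 by rewrite -expR0 ler_expR oppr_le0 mulr_ge0 ?sqr_ge0 ?ltW.
have xm : `|x| ^+ m * E <= 1 + N / a ^+ m.
  (* The inequality [u <= 1 + u^2] for [u = |x|^m] turns an arbitrary power of [|x|] into a power of
     [x^2], which is what the exponential controls. *)
  have xm2 : `|x| ^+ m <= 1 + (x ^+ 2) ^+ m.
    rewrite -real_normK ?num_real // exprAC; set u := _ ^+ m.
    have u0 : 0 <= u by rewrite exprn_ge0.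
    nra.
  apply: le_trans (ler_wpM2r E0 xm2) _; rewrite mulrDl mul1r; apply: lerD => //.
  have ax0 : 0 <= a * x ^+ 2 by rewrite mulr_ge0 ?sqr_ge0 ?ltW.
  rewrite ler_pdivlMr ?exprn_gt0 // /E expRN mulrAC ler_pdivrMr ?expR_gt0 //.
  by rewrite mulrC -exprMn hN.
apply: le_trans (_ : (`|x| ^+ m.+1 * `|q.[x]| * E + `|c| * (`|x| ^+ m * E) <= _)).
  rewrite exprSr [X in _ <= X](_ : _ = `|x| ^+ m * (`|q.[x] * x| + `|c|) * E).
    by rewrite ler_wpM2r // ler_wpM2l ?exprn_ge0 // ler_normD.
  by rewrite normrM; ring.
by rewrite lerD // ler_wpM2l.
Qed.

(* Closed under differentiation: [(q e^(-p))' = (q' - q p') e^(-p)]. *)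
Lemma schwartz_poly_expR q p a (C : R) : 0 < a ->
  (forall x, a * x ^+ 2 - C <= p.[x]) ->
  schwartz (fun x => (q.[x] * expR (- p.[x]))%:C).
Proof.
move=> a0 pC; apply: (@schwartz_coind _ (fun h => exists u : {poly R},
    h = fun x => (u.[x] * expR (- p.[x]))%:C)); last by exists q.
  move=> _ [u ->]; exists (fun x => ((u^`() - u * p^`()).[x] * expR (- p.[x]))%:C).
    apply: cderive_real => x.
    have dN : is_derive x 1 (fun y => - p.[y]) (- p^`().[x]).
      exact: is_deriveN1 (is_derive_poly p x).
    have dE := is_derive_comp1 (g := fun y => - p.[y]) (is_derive_expR _) dN.
    apply: (is_derive_eq (is_deriveM1 (is_derive_poly u x) dE)).
    rewrite hornerD hornerN hornerM. ring.
  by exists (u^`() - u * p^`()).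
move=> _ [u ->] m; have [M hM] := horner_gauss_bounded u m a0.
exists (M * expR C) => x.
rewrite nc_real normrM [ `|expR _|]ger0_norm ?expR_ge0 //.
apply: le_trans (_ : `|x| ^+ m * `|u.[x]| * expR (- (a * x ^+ 2)) * expR C <= _).
  rewrite -!mulrA ler_wpM2l ?exprn_ge0 // ler_wpM2l // -expRD ler_expR.
  by have := pC x; lra.
by rewrite ler_wpM2r ?expR_ge0.
Qed.

Definition gauss a x : R[i] := (expR (- (a * x ^+ 2)))%:C.

Lemma schwartz_gauss a : 0 < a -> schwartz (gauss a).
Proof.
move=> a0; have := @schwartz_poly_expR 1 (a%:P * 'X^2) a 0 a0.
rewrite (_ : (fun x => _) = gauss a); last first.
  by apply/funext => x; rewrite /gauss !hornerE.
by apply=> x; rewrite !hornerE subr0.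
Qed.

Lemma cderive_gauss a : cderive (gauss a) (fun x => (- (2 * a * x))%:C * gauss a x).
Proof.
apply: cderive_eq.
  apply: (@cderive_real _ _ (fun x => expR (- (a * x ^+ 2)) * - (2 * a * x))) => x.
  apply: (is_derive_comp1 (is_derive_expR _)); apply: is_deriveN1.
  apply: (is_derive_eq (is_deriveM1 (is_derive_cst a x 1)
    (is_deriveM1 (is_derive_id x 1) (is_derive_id x 1)))).
  by rewrite /=; ring.
by move=> x; rewrite mulrC rmorphM.
Qed.

(** This is [e^(- (a + i b) x^2 + i s x)]. The trailing [+ 0] gives the phase the exact shape of
    [schwartz_chirp]. *)
Definition cgauss a b s x : R[i] := gauss a x * expi (- b * x ^+ 2 + s * x + 0).

Lemma schwartz_cgauss a b s : 0 < a -> schwartz (cgauss a b s).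
Proof. by move=> a0; apply: schwartz_chirp; exact: schwartz_gauss. Qed.

Lemma cderive_cgauss a b s : cderive (cgauss a b s)
  (fun x => ('i * s%:C - (2 * (a +i* b)) * x%:C) * cgauss a b s x).
Proof.
apply: cderive_eq.
  apply: (cderiveM (@cderive_gauss a)).
  apply: (@cderive_expi _ _ (fun x => 2 * - b * x + s)) => x.
  exact: is_derive_quadratic.
move=> x; rewrite /cgauss; set E := expi _; set F := gauss a x.
rewrite [a +i* b](_ : _ = a%:C + 'i * b%:C); last by apply: complex_eq; rewrite !reimE /=; ring.
by rewrite !rmorphD !rmorphN !rmorphM !rmorphN rmorph_nat /=; ring.
Qed.

Definition gauss_integral a b s : R[i] := Cintegral (cgauss a b s).

Section FixedWidth.
Variable (a : R).
Hypothesis a_gt0 : 0 < a.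
Variable (b : R).
Let z : R[i] := a +i* b.
Let N2 : R := a ^+ 2 + b ^+ 2.

Let N2_gt0 : 0 < N2.
Proof. by rewrite ltr_pwDl ?sqr_ge0 ?exprn_gt0. Qed.

Let z_neq0 : z != 0.
Proof. by apply/eqP => /(congr1 re) /= az; move: a_gt0; rewrite az ltxx. Qed.

Let Jint s : Cint (cgauss a b s).
Proof. by apply: schwartz_Cint; exact: schwartz_cgauss. Qed.

Let JintX s : Cint (fun x => x%:C * cgauss a b s x).
Proof. by apply/schwartz_Cint/schwartzX/schwartz_cgauss. Qed.

(** The derivative [(i s - 2 z x)] times the Gaussian has integral 0. *)
Lemma gauss_moment1 s :
  Cintegral (fun x => x%:C * cgauss a b s x) = 'i * s%:C / (2 * z) * gauss_integral a b s.
Proof.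
have z2 : 2 * z != 0 by rewrite mulf_neq0 ?pnatr_eq0.
have E : 2 * z * ('i * s%:C / (2 * z) * gauss_integral a b s) =
    'i * s%:C * gauss_integral a b s by rewrite mulrA [2 * z * _]mulrC divfK.
apply: (mulfI z2); rewrite E; apply/esym/eqP.
rewrite -subr_eq0 -!CintegralZ // -CintegralB; [|exact: CintZ..].
apply/eqP/(@Cintegral_derive0 _ (cgauss a b s)).
- by apply: cderive_eq; [exact: cderive_cgauss|move=> x /=; rewrite -/z; ring].
- exact: schwartz_cgauss.
- by apply: schwartzB; apply: schwartzZ; [|apply: schwartzX]; exact: schwartz_cgauss.
Qed.

(** The same argument applied to [x] times the Gaussian, whose derivative at [s = 0] is
    [(1 - 2 z x^2)] times the Gaussian. *)
Lemma gauss_moment2 :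
  Cintegral (fun x => (x ^+ 2)%:C * cgauss a b 0 x) = (2 * z)^-1 * gauss_integral a b 0.
Proof.
have z2 : 2 * z != 0 by rewrite mulf_neq0 ?pnatr_eq0.
have sX2 : schwartz (fun x => (x ^+ 2)%:C * cgauss a b 0 x).
  rewrite (_ : (fun x => _) = fun x => x%:C * (x%:C * cgauss a b 0 x)).
    by do 2 apply: schwartzX; exact: schwartz_cgauss.
  by apply/funext => x; rewrite rmorphXn /=; ring.
apply: (mulfI z2); rewrite mulrA mulfV // mul1r; apply/esym/eqP.
rewrite -subr_eq0 -!CintegralZ //; last exact: schwartz_Cint.
rewrite -CintegralB //; last by apply: CintZ; exact: schwartz_Cint.
apply/eqP/(@Cintegral_derive0 _ (fun x => x%:C * cgauss a b 0 x)).
- apply: cderive_eq; first apply: cderive_X; first exact: cderive_cgauss.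
  by move=> x /=; rewrite -/z rmorphXn /=; ring.
- by apply: schwartzX; exact: schwartz_cgauss.
- apply: schwartzB; first exact: schwartz_cgauss.
  exact: schwartzZ.
Qed.

Lemma gauss_integral_s s : gauss_integral a b s =
  gauss_integral a b 0 * (expR (- (a / (4 * N2)) * s ^+ 2))%:C * expi (b / (4 * N2) * s ^+ 2).
Proof.
(* [al - i be] is [1 / (4 z)], split into its real and imaginary parts. *)
pose al := a / (4 * N2); pose be := b / (4 * N2).
have dJ : cderive (gauss_integral a b)
    (fun s => - (s%:C / (2 * z)) * gauss_integral a b s).
  have := @cderive_oscillatory R (cgauss a b 0) id (@measurable_id _ _ _) (Jint 0) (JintX 0).
  rewrite (_ : (fun t => Cintegral _) = gauss_integral a b); last first.
    apply/funext => t; congr Cintegral; apply/funext => y.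
    by rewrite /cgauss -mulrA -expiD; congr (_ * expi _); ring.
  move=> d; apply: cderive_eq; first exact: d.
  move=> t /=; transitivity ('i * Cintegral (fun x => x%:C * cgauss a b t x)).
    rewrite -CintegralZ //; congr Cintegral; apply/funext => y.
    rewrite /cgauss -!mulrA -expiD; congr (_ * (_ * (_ * expi _))); ring.
  rewrite gauss_moment1 !mulrA -expr2 sqr_i; ring.
(* [W] is [e^(s^2 / (4 z))]. It solves the opposite equation, so its product with the integral is
   constant in [s]; [gauss] is used here with a negative parameter and grows. *)
pose W s := expi (- be * s ^+ 2 + 0 * s + 0) * gauss (- al) s.
have dW : cderive W (fun s => s%:C / (2 * z) * W s).
  apply: cderive_eq.
    apply: (cderiveM _ (@cderive_gauss (- al))).
    apply: (@cderive_expi _ _ (fun x => 2 * - be * x + 0)) => x.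
    exact: is_derive_quadratic.
  move=> x; rewrite /W; set E := expi _; set F := gauss _ x.
  have -> : x%:C / (2 * z) = (2 * al * x)%:C - 'i * (2 * be * x)%:C.
    have z2 : 2 * z != 0 by rewrite mulf_neq0 ?pnatr_eq0.
    apply: (mulIf z2); rewrite divfK //.
    have N0 : N2 != 0 by rewrite gt_eqF.
    apply: complex_eq; rewrite !reimE /= /al /be /N2; field; exact: N0.
  by clearbody al be; rewrite addr0 !rmorphN !rmorphM !rmorphN rmorph_nat /=; ring.
have dJW : cderive (fun s => gauss_integral a b s * W s) (fun=> 0).
  by apply: cderive_eq; [exact: cderiveM dJ dW|move=> x /=; ring].
have W0 : W 0 = 1.
  by rewrite /W /gauss expr0n !mulr0 !addr0 oppr0 expi0 expR0 mul1r.
have := cderive0_cst dJW s 0; rewrite W0 mulr1 => <-.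
have E1 : expi (- be * s ^+ 2 + 0 * s + 0) * expi (be * s ^+ 2) = 1.
  by rewrite -expiD (_ : _ + _ = 0) ?expi0 //; ring.
have E2 : gauss (- al) s * (expR (- al * s ^+ 2))%:C = 1.
  by rewrite /gauss -rmorphM -expRD (_ : _ + _ = 0) ?expR0 //; ring.
rewrite -/al -/be /W.
transitivity (gauss_integral a b s * (expi (- be * s ^+ 2 + 0 * s + 0) * expi (be * s ^+ 2))
  * (gauss (- al) s * (expR (- al * s ^+ 2))%:C)); last by ring.
by rewrite E1 E2 !mulr1.
Qed.

End FixedWidth.

Lemma Rintegral_gauss a m : 0 < a ->
  rint (fun x => expR (- (a * (x - m) ^+ 2))) /\
  \int[leb]_x expR (- (a * (x - m) ^+ 2)) = Num.sqrt (pi / a).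
Proof.
(* The standard deviation for which the Gaussian is a multiple of the normal density. *)
move=> a0; pose s := Num.sqrt (2 * a)^-1.
have s2 : s ^+ 2 = (2 * a)^-1 by rewrite sqr_sqrtr // invr_ge0 mulr_ge0 // ltW.
have s0 : s != 0 by rewrite gt_eqF // sqrtr_gt0 invr_gt0 mulr_gt0.
have -> : (fun x => expR (- (a * (x - m) ^+ 2))) =
    fun x => (normal_peak s)^-1 * normal_pdf m s x.
  apply/funext => x; rewrite normal_pdfE // mulKf ?gt_eqF ?normal_peak_gt0 //.
  by rewrite /normal_fun s2; congr expR; field; rewrite gt_eqF.
have ip := @integrable_normal_pdf R m s; split; first exact: rintZ.
rewrite RintegralZT // [X in _ * X](_ : _ = 1).
  rewrite mulr1 /normal_peak invrK s2; congr Num.sqrt.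
  by rewrite -mulr_natr; field; rewrite gt_eqF.
by rewrite /Rintegral integral_normal_pdf.
Qed.

Lemma gauss_integral_00 a : 0 < a -> gauss_integral a 0 0 = (Num.sqrt (pi / a))%:C.
Proof.
move=> a0; have -> : gauss_integral a 0 0 =
    Cintegral (fun x => (expR (- (a * (x - 0) ^+ 2)))%:C).
  congr Cintegral; apply/funext => x.
  by rewrite /cgauss /gauss oppr0 !mul0r !addr0 expi0 mulr1.
apply: complex_eq => /=; first by rewrite (Rintegral_gauss 0 a0).2.
by rewrite Rintegral_cst // mul0r.
Qed.

(* The principal square root of [a + ib] in polar form. *)
Definition csqrt a b : R[i] :=
  (expR (ln (a ^+ 2 + b ^+ 2) / 4))%:C * expi (atan (b / a) / 2).

Lemma cderive_csqrt a : 0 < a ->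
  cderive (csqrt a) (fun b => 'i / (2 * (a +i* b)) * csqrt a b).
Proof.
move=> a0.
have Np b : 0 < a ^+ 2 + b ^+ 2 by rewrite ltr_pwDl ?sqr_ge0 ?exprn_gt0.
apply: cderive_eq.
  apply: cderiveM.
    apply: (@cderive_real _ _ (fun b => expR (ln (a ^+ 2 + b ^+ 2) / 4) *
       ((a ^+ 2 + b ^+ 2)^-1 * (2 * b) / 4))) => b.
    have d1 : is_derive b 1 (fun y => a ^+ 2 + y * y) (2 * b).
      apply: (is_derive_eq (is_deriveD1 (is_derive_cst (a ^+ 2) b 1)
        (is_deriveM1 (is_derive_id b 1) (is_derive_id b 1)))).
      by rewrite add0r mulr1 mul1r; ring.
    have d2 := is_derive_comp1 (g := fun y => a ^+ 2 + y * y) (is_derive1_ln (Np b)) d1.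
    have d3 := is_deriveM1 d2 (is_derive_cst (4^-1 : R) b 1).
    apply: (is_derive_eq (is_derive_comp1 (g := fun y => ln (a ^+ 2 + y * y) * 4^-1)
      (is_derive_expR _) d3)).
    by rewrite mulr0 add0r.
  apply: (@cderive_expi _ _ (fun b => (1 + (b / a) ^+ 2)^-1 * a^-1 / 2)) => b.
  have d1 : is_derive b 1 (fun y => y / a) a^-1.
    apply: (is_derive_eq (is_deriveM1 (is_derive_id b 1) (is_derive_cst (a^-1) b 1))).
    by rewrite mulr0 add0r mul1r.
  have d2 := is_derive_comp1 (g := fun y => y / a) (is_derive1_atan (b / a)) d1.
  apply: (is_derive_eq (is_deriveM1 d2 (is_derive_cst (2^-1 : R) b 1))).
  by rewrite mulr0 add0r.
move=> b; rewrite /csqrt; set E := expR _; set F := expi _.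
have z2 : 2 * (a +i* b) != 0.
  rewrite mulf_neq0 ?pnatr_eq0 //.
  by apply/eqP => /(congr1 re) /= az; move: a0; rewrite az ltxx.
(* The real part is the derivative in [b] of the logarithm of the modulus of [csqrt a b], the
   imaginary part that of its argument. *)
have -> : 'i / (2 * (a +i* b)) =
    ((a ^+ 2 + b ^+ 2)^-1 * (2 * b) / 4)%:C + 'i * ((1 + (b / a) ^+ 2)^-1 * a^-1 / 2)%:C.
  apply: (mulIf z2); rewrite divfK //.
  have N0 : a ^+ 2 + b ^+ 2 != 0 by rewrite gt_eqF.
  have a_0 : a != 0 by rewrite gt_eqF.
  by apply: complex_eq; rewrite !reimE /=; field; rewrite a_0 N0.
by rewrite !rmorphM /=; ring.
Qed.

(** By [gauss_moment2] the integral satisfies [J' = - i / (2 z) J] in [b], and [csqrt] the opposite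
    equation. Starting from the real Gaussian at [b = 0], the constancy of the product selects the
    branch of the square root without contour integration. *)
Lemma gauss_integral_b0 a b : 0 < a ->
  gauss_integral a b 0 * csqrt a b = (Num.sqrt pi)%:C.
Proof.
move=> a0.
have z0 c : a +i* c != 0.
  by apply/eqP => /(congr1 re) /= az; move: a0; rewrite az ltxx.
have dJ : cderive (fun b => gauss_integral a b 0)
    (fun b => - ('i / (2 * (a +i* b))) * gauss_integral a b 0).
  have mq : measurable_fun setT (fun x : R => - x ^+ 2) by apply: measurable_funN; exact: measurable_funX.
  have iq : Cint (fun y => (- y ^+ 2)%:C * gauss a y).
    rewrite (_ : (fun y => _) = fun y => -1 * (y%:C * (y%:C * gauss a y))).
      by apply/CintZ/schwartz_Cint; do 2 apply: schwartzX; exact: schwartz_gauss.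
    by apply/funext => y; rewrite rmorphN rmorphXn /=; ring.
  have := @cderive_oscillatory R (gauss a) _ mq (schwartz_Cint (schwartz_gauss a0)) iq.
  rewrite (_ : (fun t => Cintegral _) = (fun b => gauss_integral a b 0)); last first.
    apply/funext => t; congr Cintegral; apply/funext => y.
    by rewrite /cgauss; congr (_ * expi _); ring.
  move=> d; apply: cderive_eq; first exact: d.
  move=> c /=; transitivity (- 'i * Cintegral (fun x => (x ^+ 2)%:C * cgauss a c 0 x)).
    rewrite -CintegralZ.
      congr Cintegral; apply/funext => y.
      rewrite /cgauss rmorphN mulNr mulrN mulNr mulNr -!mulrA.
      by congr (- (_ * (_ * (_ * expi _)))); ring.
    apply: schwartz_Cint.
    rewrite (_ : (fun x => _) = fun x => x%:C * (x%:C * cgauss a c 0 x)).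
      by do 2 apply: schwartzX; exact: schwartz_cgauss.
    by apply/funext => x; rewrite rmorphXn /=; ring.
  by rewrite gauss_moment2 // mulrA mulNr.
have dJW : cderive (fun b => gauss_integral a b 0 * csqrt a b) (fun=> 0).
  by apply: cderive_eq; [exact: cderiveM dJ (cderive_csqrt a0)|move=> x /=; ring].
rewrite (cderive0_cst dJW b 0) gauss_integral_00 // /csqrt mul0r atan0 mul0r expi0 mulr1.
rewrite -rmorphM expr0n /= addr0; congr (_%:C).
have -> : expR (ln (a ^+ 2) / 4) = Num.sqrt a.
  apply/eqP; rewrite -(@eqrXn2 _ 2) ?sqrtr_ge0 ?expR_ge0 // sqr_sqrtr ?ltW //.
  rewrite -expRM_natl lnXn // (_ : 2%:R * _ = ln a) ?lnK //.
  by rewrite -mulr_natr; field.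
by rewrite -sqrtrM ?divr_ge0 ?pi_ge0 ?ltW // divfK ?gt_eqF.
Qed.

End Gaussians.

(** * Fresnel identity and Fourier inversion *)

Section Inversion.
Context {R : realType}.
Implicit Types (f g h : R -> R[i]) (a b c k t s x y : R) (z w : R[i]) (p q : {poly R}).
Local Notation re := (@complex.Re R).
Local Notation im := (@complex.Im R).
Local Notation nc := (@ComplexField.Normc.normc R).
Local Notation leb := (@lebesgue_measure R).

Lemma gauss_integralE a b s : 0 < a -> gauss_integral a b s =
  (Num.sqrt pi * expR (- (ln (a ^+ 2 + b ^+ 2) / 4)) *
    expR (- (a / (4 * (a ^+ 2 + b ^+ 2))) * s ^+ 2))%:C *
  expi (- (atan (b / a) / 2) + b / (4 * (a ^+ 2 + b ^+ 2)) * s ^+ 2).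
Proof.
move=> a0; rewrite gauss_integral_s //.
have -> : gauss_integral a b 0 =
    (Num.sqrt pi)%:C * ((expR (- (ln (a ^+ 2 + b ^+ 2) / 4)))%:C * expi (- (atan (b / a) / 2))).
  rewrite -(gauss_integral_b0 b a0) /csqrt.
  transitivity (gauss_integral a b 0 * ((expR (ln (a ^+ 2 + b ^+ 2) / 4))%:C *
      (expR (- (ln (a ^+ 2 + b ^+ 2) / 4)))%:C) *
      (expi (- (atan (b / a) / 2)) * expi (atan (b / a) / 2))); last by ring.
  by rewrite expiNK -rmorphM -expRD subrr expR0 !mulr1.
by rewrite expiD !rmorphM; ring.
Qed.

Lemma FT_cgauss k a b s x : FT k (cgauss a b s) x = gauss_integral a b (k * x + s).
Proof.
congr Cintegral; apply/funext => y; rewrite /cgauss -mulrA -expiD.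
by congr (_ * expi _); ring.
Qed.

Lemma cvg_seq_expR (u : nat -> R) (l : R) : u n @[n --> \oo] --> l ->
  expR (u n) @[n --> \oo] --> expR l.
Proof. by move=> ul; exact: (cvg_comp _ _ ul (@continuous_expR R l)). Qed.

Lemma cvg_seq_ln (u : nat -> R) (l : R) : 0 < l -> u n @[n --> \oo] --> l ->
  ln (u n) @[n --> \oo] --> ln l.
Proof. by move=> l0 ul; exact: (cvg_comp _ _ ul (continuous_ln l0)). Qed.

Lemma cvg_harmonic_sqr : ((n.+1%:R : R)^-1 ^+ 2) @[n --> \oo] --> (0 : R).
Proof.
rewrite -[X in _ --> X](mulr0 0); under eq_fun do rewrite expr2.
by apply: cvgM; exact: cvg_harmonic.
Qed.

(** The regularising parameters form a sequence of squares, so that [n.+1%:R^-1] is their square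
    root: the length scale on which the kernel of [FT_inversion] concentrates. *)
Let a_ (n : nat) : R := (n.+1%:R)^-1 ^+ 2.

Let a_gt0 n : 0 < a_ n.
Proof. by rewrite exprn_gt0 // invr_gt0. Qed.

(** The source of the Fresnel phase: the argument of [a + i b] tends to [pi / 2], and the square
    root halves it. *)
Lemma cvg_atan_scaled b : 0 < b -> atan (b / a_ n) @[n --> \oo] --> pi / 2.
Proof.
move=> b0; apply: (@cvg_comp _ _ _ (fun n => b / a_ n) (@atan R) _ (pinfty_nbhs R)).
  apply/cvgryPge => A; near=> n.
  rewrite /a_ -exprVn invrK -ler_pdivrMl //.
  have : A / b <= n%:R by near: n; exact: nbhs_infty_ger.
  rewrite mulrC => h; apply: le_trans h _; rewrite -natrX ler_nat; nia.
exact: cvgy_atan.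
Unshelve. all: end_near. Qed.

(** Common start of both identities. [FT_fubini] moves one transform onto the Gaussian, where it is
    known explicitly; on the other side the Gaussian factor has modulus at most 1, so [|FT k f|]
    dominates. *)
Lemma ccvg_regularized k b t f : k != 0 -> schwartz f ->
  ccvg (fun n => Cintegral (fun x => f x * gauss_integral (a_ n) b (k * x + k * t)))
    (FT k (fun y => FT k f y * expi (- b * y ^+ 2)) t).
Proof.
move=> k0 sf; have [G rG fG] := Cint_majorant (schwartz_Cint (schwartz_FT k0 sf)).
have -> : (fun n => Cintegral (fun x => f x * gauss_integral (a_ n) b (k * x + k * t))) =
    (fun n => Cintegral (fun y => FT k f y * cgauss (a_ n) b (k * t) y)).
  apply/funext => n.
  apply: etrans (esym (FT_fubini k sf (schwartz_cgauss b (k * t) (a_gt0 n)))).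
  by congr Cintegral; apply/funext => x; rewrite FT_cgauss.
apply: (ccvg_Cintegral (G := G)) => //.
- move=> n; apply: cmeasM; first exact/schwartz_cmeas/schwartz_FT.
  exact/schwartz_cmeas/schwartz_cgauss.
- move=> y; rewrite /cgauss /gauss.
  rewrite (_ : FT k f y * _ * _ = FT k f y * (1%:C * expi (- b * y ^+ 2 + k * t * y + 0))); last first.
    by rewrite mul1r -mulrA -expiD addr0.
  apply: ccvgM; first exact: ccvg_cst.
  apply: ccvgM; last exact: ccvg_cst.
  apply: ccvg_real; rewrite -[X in _ --> X]expR0.
  apply: cvg_seq_expR.
  rewrite -[X in _ --> X]oppr0; apply: cvgN; rewrite -[X in _ --> X](mul0r (y ^+ 2)).
  by apply: cvgM; [exact: cvg_harmonic_sqr|exact: cvg_cst].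
- move=> n y; apply: le_trans (fG y); rewrite /cgauss !ncM nc_expi mulr1 nc_real.
  rewrite ger0_norm ?expR_ge0 // ler_piMr ?nc_ge0 // -expR0 ler_expR oppr_le0.
  by rewrite mulr_ge0 ?sqr_ge0 // ltW.
Qed.

Lemma FT_chirp_FT k t f : 0 < k -> schwartz f ->
  FT k (fun y => FT k f y * expi (- (k / 2) * y ^+ 2)) t =
  (Num.sqrt (2 * pi / k))%:C * expi (- (pi / 4)) * expi (k / 2 * t ^+ 2) *
    FT k (fun x => f x * expi (k / 2 * x ^+ 2)) t.
Proof.
move=> k0 sf; have kn0 : k != 0 by rewrite gt_eqF.
pose b := k / 2; have b0 : 0 < b by rewrite divr_gt0.
have b20 : 0 < b ^+ 2 by rewrite exprn_gt0.
(* The limit [sqrt(pi / b)] of the modulus of the Gaussian transform as [a] tends to 0. *)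
pose c0 := Num.sqrt pi * expR (- (ln (b ^+ 2) / 4)).
have c0E : c0 = Num.sqrt (2 * pi / k).
  have E : expR (ln (b ^+ 2) / 4) = Num.sqrt b.
    apply/eqP; rewrite -(@eqrXn2 _ 2) ?sqrtr_ge0 ?expR_ge0 // sqr_sqrtr ?ltW //.
    rewrite -expRM_natl lnXn // (_ : 2%:R * _ = ln b) ?lnK //.
    by rewrite -mulr_natr; field.
  rewrite /c0 expRN E -sqrtrV ?ltW // -sqrtrM ?pi_ge0 //; congr Num.sqrt.
  by rewrite /b; field.
have lim := ccvg_regularized b t kn0 sf.
have [G rG fG] := Cint_majorant (schwartz_Cint sf).
have cN : (a_ n ^+ 2 + b ^+ 2) @[n --> \oo] --> b ^+ 2.
  rewrite -[X in _ --> X]add0r; apply: cvgD; last exact: cvg_cst.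
  rewrite -[X in _ --> X](mulr0 0); under eq_fun do rewrite expr2.
  by apply: cvgM; exact: cvg_harmonic_sqr.
have cNV : (4 * (a_ n ^+ 2 + b ^+ 2))^-1 @[n --> \oo] --> (4 * b ^+ 2)^-1.
  apply: cvgV; first by rewrite gt_eqF // mulr_gt0.
  by apply: cvgM => //; exact: cvg_cst.
have lim2 : ccvg (fun n => Cintegral (fun x => f x * gauss_integral (a_ n) b (k * x + k * t)))
    (Cintegral (fun x => f x * (c0%:C * expi (- (pi / 2 / 2) +
       b / (4 * b ^+ 2) * (k * x + k * t) ^+ 2)))).
  apply: (ccvg_Cintegral (G := fun x => c0 * G x)).
  - move=> n; apply: cmeasM; first exact: schwartz_cmeas.
    have -> : (fun x => gauss_integral (a_ n) b (k * x + k * t)) =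
        (fun x => FT k (cgauss (a_ n) b (k * t)) x) by apply/funext => x; rewrite FT_cgauss.
    by apply/schwartz_cmeas/schwartz_FT => //; exact: schwartz_cgauss.
  - move=> x; apply: ccvgM; first exact: ccvg_cst.
    rewrite (_ : (fun n => _) = fun n => (Num.sqrt pi *
        expR (- (ln (a_ n ^+ 2 + b ^+ 2) / 4)) *
        expR (- (a_ n / (4 * (a_ n ^+ 2 + b ^+ 2))) * (k * x + k * t) ^+ 2))%:C *
        expi (- (atan (b / a_ n) / 2) + b / (4 * (a_ n ^+ 2 + b ^+ 2)) * (k * x + k * t) ^+ 2)).
      apply: ccvgM.
        apply: ccvg_real; rewrite -[X in _ --> X]mulr1; apply: cvgM.
          apply: cvgM; first exact: cvg_cst.
          apply: cvg_seq_expR.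
          apply: cvgN; apply: cvgM; last exact: cvg_cst.
          exact: cvg_seq_ln.
        rewrite -[X in _ --> X]expR0.
        apply: cvg_seq_expR.
        rewrite -[X in _ --> X](mul0r ((k * x + k * t) ^+ 2)).
        apply: cvgM; last exact: cvg_cst.
        rewrite -[X in _ --> X]oppr0; apply: cvgN; rewrite -[X in _ --> X](mul0r (4 * b ^+ 2)^-1).
        by apply: cvgM => //; exact: cvg_harmonic_sqr.
      apply: ccvg_expi; apply: cvgD.
        apply: cvgN; apply: cvgM; last exact: cvg_cst.
        exact: cvg_atan_scaled.
      apply: cvgM; last exact: cvg_cst.
      by apply: cvgM => //; exact: cvg_cst.
    by apply/funext => n; rewrite gauss_integralE.
  - exact: rintZ.
  (* Since [a^2 + b^2 >= b^2 > 0] and the real exponent is nonpositive, [c0] bounds the transform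
     for every [n]. *)
  - move=> n x; rewrite ncM gauss_integralE // ncM nc_expi mulr1 nc_real mulrC.
    apply: ler_pM => //; first exact: nc_ge0.
    rewrite ger0_norm ?mulr_ge0 ?expR_ge0 ?sqrtr_ge0 //.
    have N0 : 0 < a_ n ^+ 2 + b ^+ 2 by rewrite ltr_pwDl ?sqr_ge0 ?exprn_gt0.
    rewrite -[leRHS]mulr1; apply: ler_pM; rewrite ?mulr_ge0 ?expR_ge0 ?sqrtr_ge0 //.
      rewrite ler_wpM2l ?sqrtr_ge0 // ler_expR lerN2 ler_pM2r ?invr_gt0 //.
      by rewrite ler_ln ?posrE // lerDr sqr_ge0.
    rewrite -expR0 ler_expR mulNr oppr_le0 mulr_ge0 ?sqr_ge0 //.
    by rewrite divr_ge0 ?mulr_ge0 // ltW.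
rewrite (ccvg_unique lim lim2) c0E /FT -CintegralZ; last first.
  apply/schwartz_Cint/schwartz_wave; have := schwartz_chirp (k / 2) 0 0 sf; congr schwartz.
  by apply/funext => x; rewrite mul0r !addr0.
congr Cintegral; apply/funext => x.
(* The choice [b = k / 2] makes the coefficient of [(x + t)^2] equal to [k / 2], so the cross term
   is exactly the phase [k t x] of the kernel and the squares are the inverse chirps. *)
rewrite (_ : - (pi / 2 / 2) + _ = - (pi / 4) + k / 2 * t ^+ 2 + (k / 2 * x ^+ 2 + k * t * x)).
  by rewrite !expiD; ring.
by rewrite /b; field.
Qed.

(** The mean value theorem is applied to each component, hence the factor 2 over a bound of [f']. *)
Lemma schwartz_lipschitz f : schwartz f ->
  exists2 K, 0 <= K & forall x y, nc (f x - f y) <= K * `|x - y|.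
Proof.
move=> sf; have [f' df sf'] := schwartz_cderive sf.
have [M hM] := schwartz_rapid sf' 0.
have lip (u u' : R -> R) : (forall x : R, is_derive x 1 u (u' x)) ->
    (forall x, `|u' x| <= M) -> forall x y, `|u x - u y| <= M * `|x - y|.
  move=> du u'M; suff le_case x y : x <= y -> `|u x - u y| <= M * `|x - y|.
    by move=> x y; have [/le_case//|/ltW/le_case] := leP x y; rewrite distrC [ `|y - x|]distrC.
  move=> xy; have cu : {within `[x, y], continuous u}.
    apply: continuous_subspaceT => v.
    by apply/differentiable_continuous/derivable1_diffP; have [] := du v.
  have [v _] := MVT_segment xy (fun v _ => du v) cu.
  by rewrite distrC [ `|x - y|]distrC => ->; rewrite normrM ler_wpM2r.
have M0 : 0 <= M by apply: le_trans (hM 0); rewrite expr0 mul1r nc_ge0.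
exists (2 * M); first by rewrite mulr_ge0.
move=> x y; apply: le_trans (nc_le_reim _) _; rewrite reD imD reN imN.
rewrite -mulrA mulr2n mulrDl mul1r; apply: lerD.
  apply: (lip (re \o f) (re \o f')) => v; first by have [] := df v.
  by apply: le_trans (le_re_nc _) _; have := hM v; rewrite expr0 mul1r.
apply: (lip (im \o f) (im \o f')) => v; first by have [] := df v.
by apply: le_trans (le_im_nc _) _; have := hM v; rewrite expr0 mul1r.
Qed.

(** Again a vanishing integral of a derivative, that of [(x - m) e^(- c (x - m)^2)]. *)
Lemma Rintegral_gauss_moment2 c m : 0 < c ->
  rint (fun x => (x - m) ^+ 2 * expR (- (c * (x - m) ^+ 2))) /\
  \int[leb]_x ((x - m) ^+ 2 * expR (- (c * (x - m) ^+ 2))) =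
    (2 * c)^-1 * Num.sqrt (pi / c).
Proof.
move=> c0; pose p : {poly R} := c%:P * ('X - m%:P) ^+ 2.
have pE x : p.[x] = c * (x - m) ^+ 2 by rewrite /p !hornerE.
pose g x : R[i] := (expR (- (c * (x - m) ^+ 2)))%:C.
have sg (q : {poly R}) : schwartz (fun x => q.[x]%:C * g x).
  (* These constants encode [(x - m)^2 >= x^2 / 2 - m^2], which amounts to [(x - 2 m)^2 >= 0]. *)
  have := @schwartz_poly_expR _ q p (c / 2) (c * m ^+ 2).
  rewrite divr_gt0 // => /(_ isT); rewrite (_ : (fun x => _) = fun x => q.[x]%:C * g x).
    apply=> x; rewrite pE -mulrA -mulrBr ler_wpM2l ?(ltW c0) //.
    by have := sqr_ge0 (x - 2 * m); nra.
  by apply/funext => x; rewrite pE -rmorphM.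
have g0 : schwartz g.
  by have := sg 1; congr schwartz; apply/funext => x; rewrite hornerC mul1r.
have g1 : schwartz (fun x => (x - m)%:C * g x).
  by have := sg ('X - m%:P); congr schwartz; apply/funext => x; rewrite !hornerE.
have g2 : schwartz (fun x => ((x - m) ^+ 2)%:C * g x).
  by have := sg (('X - m%:P) ^+ 2); congr schwartz; apply/funext => x; rewrite !hornerE.
have [i0 I0] := Rintegral_gauss m c0.
have [i2 _] := schwartz_Cint g2.
have re2 : re \o (fun x => ((x - m) ^+ 2)%:C * g x) =
    fun x => (x - m) ^+ 2 * expR (- (c * (x - m) ^+ 2)).
  by apply/funext => x /=; rewrite mul0r subr0.
rewrite re2 in i2; split => //; apply/eqP.
rewrite eq_sym -subr_eq0 -I0 -RintegralZT // -RintegralBT //; last exact: rintZ.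
have dF : cderive (fun x => (x - m)%:C * g x)
    (fun x => g x - (2 * c)%:C * (((x - m) ^+ 2)%:C * g x)).
  apply: cderive_eq.
    apply: cderiveM.
      apply: (@cderive_real _ _ (fun=> 1)) => x.
      by apply: (is_derive_eq (is_deriveB1 (is_derive_id x 1) (is_derive_cst m x 1))); rewrite subr0.
    apply: (@cderive_real _ _ (fun x => expR (- (c * (x - m) ^+ 2)) * - (2 * c * (x - m)))) => x.
    have dx : is_derive x 1 (fun x => x - m) 1.
      by apply: (is_derive_eq (is_deriveB1 (is_derive_id x 1) (is_derive_cst m x 1))); rewrite subr0.
    have d2 := is_deriveN1 (is_deriveM1 (is_derive_cst c x 1) (is_deriveM1 dx dx)).
    apply: (is_derive_eq (is_derive_comp1 (g := fun x => - (c * ((x - m) * (x - m))))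
      (is_derive_expR _) d2)).
    by rewrite /=; ring.
  by move=> x /=; apply: complex_eq; rewrite !reimE /=; ring.
have s' : schwartz (fun x => g x - (2 * c)%:C * (((x - m) ^+ 2)%:C * g x)).
  by apply: schwartzB => //; exact: schwartzZ.
have := congr1 re (Cintegral_derive0 dF g1 s') => /= E.
rewrite (_ : (fun x => _) = fun x => (2 * c)^-1 * (re \o
    (fun x => g x - (2 * c)%:C * (((x - m) ^+ 2)%:C * g x))) x); last first.
  apply/funext => x /=; rewrite !mul0r !subr0; field; exact: lt0r_neq0.
by rewrite RintegralZT ?E ?mulr0 //; have [] := schwartz_Cint s'.
Qed.

Lemma ccvg_nc (u : nat -> R[i]) z (e : nat -> R) :
  (forall n, nc (u n - z) <= e n) -> e n @[n --> \oo] --> (0 : R) -> ccvg u z.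
Proof.
move=> ue e0; split; apply/subr_cvg0; apply: norm_cvg0;
  apply: (@squeeze_cvgr _ _ _ _ (fun=> 0) e) => //; try exact: cvg_cst;
  apply/nearW => n; rewrite normr_ge0 /=; apply: le_trans (ue n).
  by have := le_re_nc (u n - z); rewrite reD reN.
by have := le_im_nc (u n - z); rewrite imD imN.
Qed.

(** For [b = 0] the transformed Gaussian is a positive kernel of mass [2 pi / k] centred at [- t].
    The error is the integral of [f x - f (- t)] against it, which the Lipschitz bound makes of the
    order of the kernel's width. *)
Theorem FT_inversion k t f : 0 < k -> schwartz f ->
  FT k (FT k f) t = (2 * pi / k)%:C * f (- t).
Proof.
move=> k0 sf; have kn0 : k != 0 by rewrite gt_eqF.
have := ccvg_regularized 0 t kn0 sf.
have -> : FT k (fun y => FT k f y * expi (- 0 * y ^+ 2)) t = FT k (FT k f) t.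
  congr FT; apply/funext => y; rewrite oppr0 mul0r expi0 mulr1 //.
move=> /ccvg_unique; apply.
have [K K0 fK] := schwartz_lipschitz sf.
(* With [e = 1 / (n + 1)] and [u = x + t], the error is at most [2 K] times the integral of
   [e + u^2 / e] against the kernel, whose mass is [2 pi / k] and whose variance is
   [2 e^2 / k^2]. *)
apply: (@ccvg_nc _ _ (fun n => 2 * K * (2 * pi / k) * (1 + 2 / k ^+ 2) * n.+1%:R^-1)); last first.
  rewrite -[X in _ --> X](mulr0 (2 * K * (2 * pi / k) * (1 + 2 / k ^+ 2))).
  by apply: cvgM; [exact: cvg_cst|exact: cvg_harmonic].
move=> n; set e := n.+1%:R^-1 : R; have e0 : 0 < e by rewrite invr_gt0.
pose c := k ^+ 2 / (4 * a_ n).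
have c0 : 0 < c by rewrite divr_gt0 ?mulr_gt0 ?exprn_gt0.
have [i0 I0] := Rintegral_gauss (- t) c0.
have [i2 I2] := Rintegral_gauss_moment2 (- t) c0.
pose A := Num.sqrt (pi / a_ n); have A0 : 0 <= A by exact: sqrtr_ge0.
pose P x := A * expR (- (c * (x - (- t)) ^+ 2)).
have P0 x : 0 <= P x by rewrite mulr_ge0 ?expR_ge0.
have AE : A * Num.sqrt (pi / c) = 2 * pi / k.
  rewrite /A -sqrtrM ?divr_ge0 ?pi_ge0 ?(ltW (a_gt0 n)) //.
  rewrite (_ : pi / a_ n * (pi / c) = (2 * pi / k) ^+ 2).
    by rewrite sqrtr_sqr ger0_norm // divr_ge0 ?mulr_ge0 ?pi_ge0 // ltW.
  by rewrite /c; field; rewrite kn0 gt_eqF.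
have JE x : gauss_integral (a_ n) 0 (k * x + k * t) = (P x)%:C.
  rewrite gauss_integral_s // gauss_integral_00 // mul0r mul0r expi0 mulr1 -rmorphM.
  rewrite /P /c opprK; congr (_ * expR _)%:C.
  by rewrite expr0n /= addr0; field; rewrite gt_eqF.
have rP : rint P by exact: rintZ.
have iP : Cint (fun x => (P x)%:C).
  split; first exact: rP.
  by have := rintZ 0 rP; congr rint; apply/funext => x; rewrite mul0r.
have IP : Cintegral (fun x => (P x)%:C) = (2 * pi / k)%:C.
  apply: complex_eq => /=; first by rewrite RintegralZT // I0.
  by rewrite Rintegral_cst // mul0r.
have [G rG fG] := Cint_majorant (schwartz_Cint sf).
have ifP : Cint (fun x => f x * (P x)%:C).
  have [iPm _] := iP.
  apply: (CintM_bounded (M := A) (schwartz_Cint sf) (Cint_cmeas iP)) => x.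
  rewrite nc_real ger0_norm // /P ler_piMr // -expR0 ler_expR oppr_le0.
  by rewrite mulr_ge0 ?sqr_ge0 // ltW.
have -> : Cintegral (fun x => f x * gauss_integral (a_ n) 0 (k * x + k * t)) -
    (2 * pi / k)%:C * f (- t) = Cintegral (fun x => (f x - f (- t)) * (P x)%:C).
  rewrite -IP [X in _ - X]mulrC -CintegralZ //; under eq_fun do rewrite JE.
  rewrite -CintegralB //; last exact: CintZ.
  by congr Cintegral; apply/funext => x; rewrite mulrBl.
(* The inequality [|u| <= e + u^2 / e] trades the absolute first moment for the mass and the second
   moment. *)
pose Q x := K * (e * P x + e^-1 * (A * ((x - (- t)) ^+ 2 * expR (- (c * (x - (- t)) ^+ 2))))).
have r2 := rintZ A i2.
have rQ : rint Q by apply: rintZ; apply: rintD; exact: rintZ.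
apply: le_trans (nc_Cintegral_le (G := Q) _ rQ _) _.
- apply: cmeasM; last exact: Cint_cmeas.
  by apply: cmeasD; [exact: schwartz_cmeas|exact: cmeas_cst].
- move=> x; rewrite ncM nc_real ger0_norm //.
  apply: le_trans (ler_wpM2r (P0 x) (fK x (- t))) _.
  rewrite /Q -mulrA ler_wpM2l //; set u := x - (- t).
  have -> : e * P x + e^-1 * (A * (u ^+ 2 * expR (- (c * u ^+ 2)))) =
     (e + e^-1 * u ^+ 2) * P x by rewrite /P -/u; ring.
  rewrite ler_wpM2r // -[u ^+ 2]real_normK ?num_real //; set v := `|u|.
  rewrite -(ler_pM2l e0) mulrDr mulrA mulfV ?gt_eqF // mul1r.
  by have := sqr_ge0 (e - v); have := sqr_ge0 e; have := sqr_ge0 v; nra.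
- rewrite /Q RintegralZT; last by apply: rintD; exact: rintZ.
  rewrite RintegralDT; [|exact: rintZ..].
  rewrite !RintegralZT // I0 I2 mulrCA [A * (_ * Num.sqrt _)]mulrCA AE.
  have -> : (2 * c)^-1 = 2 * e ^+ 2 / k ^+ 2.
    by rewrite /c /a_ -/e; field; rewrite kn0 gt_eqF.
  rewrite le_eqVlt; apply/orP; left; apply/eqP.
  by field; rewrite kn0 gt_eqF.
Qed.

End Inversion.

(** * The transform [H] on Schwartz functions *)

Section PeriodSixTransform.
Context {R : realType}.
Implicit Types (f g h : R -> R[i]) (k t x y : R) (z w : R[i]).
Local Notation re := (@complex.Re R).
Local Notation im := (@complex.Im R).
Local Notation nc := (@ComplexField.Normc.normc R).

Variable mu : R.
Hypothesis mu_gt0 : 0 < mu.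

Let k : R := 4 * pi * mu.
Let s : R := Num.sqrt (2 * mu).

Let k_gt0 : 0 < k. Proof. by rewrite !mulr_gt0 ?pi_gt0. Qed.

Let k_neq0 : k != 0. Proof. by rewrite gt_eqF. Qed.

Let s_sqr : s%:C * s%:C = (2 * mu)%:C :> R[i].
Proof. by rewrite -rmorphM -expr2 sqr_sqrtr // mulr_ge0 // ltW. Qed.

(** The constant of Fourier inversion is thus the inverse of [s^2]. *)
Let twopik : 2 * pi / k = (2 * mu)^-1.
Proof.
have p0 : pi != 0 :> R by rewrite gt_eqF ?pi_gt0.
have m0 : mu != 0 by rewrite gt_eqF.
by rewrite /k; move: pi p0 => p p0; field; rewrite m0 p0.
Qed.

Let s_neq0 : s%:C != 0 :> R[i].
Proof. by rewrite (fmorph_eq0 (real_complex R)) gt_eqF // sqrtr_gt0 mulr_gt0. Qed.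

Let chirp f x : R[i] := f x * expi (- (k / 2) * x ^+ 2).

Let schwartz_chirp_k b f : schwartz f -> schwartz (fun x => f x * expi (b * x ^+ 2)).
Proof.
move=> sf; have := schwartz_chirp b 0 0 sf; congr schwartz.
by apply/funext => x; rewrite mul0r !addr0.
Qed.

Let HE f : H mu f = fun t => i_root6 * s%:C * FT k (chirp f) t.
Proof.
apply/funext => t; congr (_ * Cintegral _); apply/funext => x.
by rewrite /chirp /e -[RHS]mulrA -expiD /k; congr (_ * expi _); field.
Qed.

Lemma schwartz_H f : schwartz f -> schwartz (H mu f).
Proof.
move=> sf; rewrite HE; apply: schwartzZ; apply: schwartz_FT => //.
exact: schwartz_chirp_k.
Qed.

Lemma schwartz_iter_H n f : schwartz f -> schwartz (iter n (H mu) f).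
Proof. by move=> sf; elim: n => // n IH; exact: schwartz_H. Qed.

Lemma H_lin z f g : schwartz f -> schwartz g ->
  H mu (fun x => z * f x + g x) = fun t => z * H mu f t + H mu g t.
Proof.
move=> sf sg; rewrite !HE; apply/funext => t.
have -> : chirp (fun x => z * f x + g x) = fun x => z * chirp f x + chirp g x.
  by apply/funext => x; rewrite /chirp; ring.
by rewrite FT_lin; [ring|exact: schwartz_chirp_k..].
Qed.

Let FTZ z f t : schwartz f -> FT k (fun x => z * f x) t = z * FT k f t.
Proof.
move=> sf; rewrite /FT -CintegralZ; last exact/schwartz_Cint/schwartz_wave.
by congr Cintegral; apply/funext => x; ring.
Qed.

(** The reason for the sixth root: its cube is inverse to the Fresnel phase. *)
Lemma i_root6_cubed : i_root6 * i_root6 * i_root6 = expi (pi / 4) :> R[i].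
Proof. by rewrite /i_root6 -!expiD; congr expi; field. Qed.

Lemma i_root6_neq0 : i_root6 != 0 :> R[i].
Proof. exact: expi_neq0. Qed.

(** The Fresnel identity turns [F M F M] into a constant times [M^-1 F], since the inner chirps
    cancel. The constants combine as [(i^(1/6) s)^2 * s^-1 * i^(-1/2) = s / i^(1/6)]. *)
Lemma H_iter2 f t : schwartz f -> iter 2 (H mu) f t =
  s%:C / i_root6 * expi (k / 2 * t ^+ 2) * FT k f t.
Proof.
move=> sf; have sc := schwartz_chirp_k (- (k / 2)) sf.
have sFc := schwartz_FT k_neq0 sc.
rewrite /= HE [H mu f]HE.
have -> : chirp (fun t => i_root6 * s%:C * FT k (chirp f) t) =
    fun y => i_root6 * s%:C * (FT k (chirp f) y * expi (- (k / 2) * y ^+ 2)).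
  by apply/funext => y; rewrite /chirp; ring.
rewrite FTZ; last exact: schwartz_chirp_k.
rewrite FT_chirp_FT // twopik.
have -> : (fun x => chirp f x * expi (k / 2 * x ^+ 2)) = f.
  by apply/funext => x; rewrite /chirp -mulrA -expiD mulNr addNr expi0 mulr1.
have -> : (Num.sqrt (2 * mu)^-1)%:C = s%:C^-1.
  by rewrite sqrtrV ?mulr_ge0 ?ltW // fmorphV.
have -> : expi (- (pi / 4)) = (i_root6 * i_root6 * i_root6)^-1 :> R[i].
  by rewrite i_root6_cubed // expiV.
by field; rewrite s_neq0 i_root6_neq0.
Qed.

(** The chirp of the third [H] cancels the one in front of [H^2], which leaves [F F] and hence the
    reflection. *)
Lemma H_iter3 f t : schwartz f -> iter 3 (H mu) f t = f (- t).
Proof.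
move=> sf; rewrite iterS HE.
have -> : chirp (iter 2 (H mu) f) = fun y => s%:C / i_root6 * FT k f y.
  apply/funext => y; rewrite /chirp H_iter2 //.
  have E : expi (k / 2 * y ^+ 2) * expi (- (k / 2) * y ^+ 2) = 1.
    by rewrite -expiD mulNr subrr expi0.
  by rewrite mulrAC -[_ / _ * _ * _]mulrA E mulr1.
rewrite FTZ; last exact: schwartz_FT.
rewrite FT_inversion // twopik (_ : (2 * mu)^-1%:C = (s%:C * s%:C)^-1); last first.
  by rewrite s_sqr fmorphV.
by field; rewrite s_neq0 i_root6_neq0.
Qed.

Lemma H_iter6 f : schwartz f -> iter 6 (H mu) f = f.
Proof.
move=> sf; apply/funext => t; rewrite (iterD 3 3) H_iter3; last exact: schwartz_iter_H.
by rewrite H_iter3 // opprK.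
Qed.

Lemma H_iter2E f t : schwartz f -> iter 2 (H mu) f t =
  s%:C / i_root6 * e (mu * t ^+ 2) * Cintegral (fun x => f x * e (2 * mu * t * x)).
Proof.
move=> sf; rewrite H_iter2 // /e.
have -> : 2 * pi * (mu * t ^+ 2) = k / 2 * t ^+ 2 by rewrite /k; field.
congr (_ * Cintegral _); apply/funext => x; congr (_ * expi _).
by rewrite /k; ring.
Qed.

(** The chirp and [i^(1/6)] have modulus 1, so the claim reduces to Parseval for [F]. Only the
    diagonal case is treated; polarisation follows in L2. *)
Lemma H_Parseval f : schwartz f ->
  Cintegral (fun t => H mu f t * conjc (H mu f t)) = Cintegral (fun x => f x * conjc (f x)).
Proof.
move=> sf; pose u := chirp f; pose F := FT k u.
have su : schwartz u by exact: schwartz_chirp_k.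
have sF : schwartz F by exact: schwartz_FT.
have sFJ := schwartzJ sF.
have mulJ g : schwartz g -> Cint (fun x => g x * conjc (g x)).
  move=> sg; have [M hM] := schwartz_rapid sg 0.
  apply: (CintM_bounded (M := M) (schwartz_Cint sg)) => [|x].
    exact/schwartz_cmeas/schwartzJ.
  by have := hM x; rewrite expr0 mul1r ncJ.
(* Conjugation reverses the frequency, and the reflection in the inversion formula reverses it
   back. *)
have FTJ x : FT k (fun y => conjc (F y)) x = (2 * mu)^-1%:C * conjc (u x).
  transitivity (conjc (FT k F (- x))).
    rewrite /FT -CintegralJ; last exact/schwartz_Cint/schwartz_wave.
    congr Cintegral; apply/funext => y.
    have -> : k * - x * y = - (k * x * y) by ring.
    by rewrite expiN conjcM conjcK.
  by rewrite FT_inversion // opprK conjcM twopik conjc_real.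
transitivity ((2 * mu)%:C * Cintegral (fun y => F y * conjc (F y))).
  rewrite -CintegralZ; last exact: mulJ.
  congr Cintegral; apply/funext => t; rewrite HE -/u -/F -s_sqr !conjcM.
  have -> : conjc (s%:C) = s%:C :> R[i] by exact: conjc_real.
  have -> : conjc i_root6 = (i_root6)^-1 :> R[i] by rewrite /i_root6 expiV expiN.
  by field; rewrite i_root6_neq0.
rewrite (FT_fubini k su sFJ).
under [in LHS]eq_fun do rewrite FTJ mulrCA.
rewrite CintegralZ; last exact: mulJ.
rewrite mulrA -rmorphM mulfV; last by rewrite gt_eqF // mulr_gt0.
rewrite mul1r; congr Cintegral; apply/funext => x.
rewrite /u /chirp conjcM -expiN.
by rewrite mulrACA -expiD mulNr opprK addNr expi0 mulr1.
Qed.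

End PeriodSixTransform.

(** * Square-integrable functions *)

Section SquareIntegrable.
Context {R : realType}.
Implicit Types (f g h s : R -> R[i]) (G : R -> R) (t x y c d : R) (z w : R[i]).
Local Notation re := (@complex.Re R).
Local Notation im := (@complex.Im R).
Local Notation nc := (@ComplexField.Normc.normc R).
Local Notation leb := (@lebesgue_measure R).

Lemma ae_imp (P Q : R -> Prop) : (forall x, P x -> Q x) ->
  {ae leb, forall x, P x} -> {ae leb, forall x, Q x}.
Proof.
have F := @ae_filter_ringOfSetsType _ _ R leb.
by move=> PQ; apply: filterS.
Qed.

(** The squared L2 norm. Working with squares avoids roots and Minkowski's inequality; [n2D] with
    its parameter [d] takes the place of the triangle inequality. *)
Definition n2 f : R := \int[leb]_x (nc (f x) ^+ 2).

Lemma measurable_nc2 f : cmeas f -> measurable_fun setT (fun x => nc (f x) ^+ 2).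
Proof.
move=> [mr mi]; rewrite (_ : (fun x => _) =
    fun x => (re \o f) x ^+ 2 + (im \o f) x ^+ 2).
  by apply: measurable_funD; exact: measurable_funX.
by apply/funext => x; rewrite sqr_nc.
Qed.

Lemma L2P f : L2 f <-> cmeas f /\ rint (fun x => nc (f x) ^+ 2).
Proof.
split=> [[mr mi fin]|[[mr mi] fin]].
  split=> //; apply/integrableP; split.
    by apply/measurable_EFinP; exact: measurable_nc2.
  by under eq_integral => x _ do rewrite /= ger0_norm ?sqr_ge0 //.
split=> //; move/integrableP: fin => [_].
by under eq_integral => x _ do rewrite /= ger0_norm ?sqr_ge0 //.
Qed.

Lemma L2_cmeas f : L2 f -> cmeas f. Proof. by move=> /L2P[]. Qed.

Lemma L2_rint f : L2 f -> rint (fun x => nc (f x) ^+ 2). Proof. by move=> /L2P[]. Qed.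

Lemma L2_le f G : cmeas f -> rint G -> (forall x, nc (f x) ^+ 2 <= G x) -> L2 f.
Proof.
move=> mf rG fG; apply/L2P; split=> //; apply: (rint_le (measurable_nc2 mf) _ rG) => x.
by rewrite ger0_norm ?sqr_ge0.
Qed.

Lemma n2_le f G : cmeas f -> rint G -> (forall x, nc (f x) ^+ 2 <= G x) ->
  n2 f <= \int[leb]_x G x.
Proof.
move=> mf rG fG; apply: le_Rintegral => //.
by have /L2P[] := L2_le mf rG fG.
Qed.

Lemma n2_ge0 f : 0 <= n2 f.
Proof. by apply: Rintegral_ge0 => x _; exact: sqr_ge0. Qed.

(** Young's inequality. [d = 1] suffices for limits, while small [d] is needed where norms must be
    preserved exactly. *)
Lemma nc2D d z w : 0 < d ->
  nc (z + w) ^+ 2 <= (1 + d) * nc z ^+ 2 + (1 + d^-1) * nc w ^+ 2.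
Proof.
move=> d0; apply: le_trans (_ : (nc z + nc w) ^+ 2 <= _).
  by rewrite lerXn2r ?nnegrE ?addr_ge0 ?nc_ge0 // ncD.
rewrite -subr_ge0 (_ : _ - _ = d^-1 * (d * nc z - nc w) ^+ 2).
  by rewrite mulr_ge0 ?sqr_ge0 // invr_ge0 ltW.
by field; rewrite gt_eqF.
Qed.

Lemma nc2D2 z w : nc (z + w) ^+ 2 <= 2 * nc z ^+ 2 + 2 * nc w ^+ 2.
Proof. by have := nc2D z w ltr01; rewrite invr1. Qed.

Lemma L2D f g : L2 f -> L2 g -> L2 (fun x => f x + g x).
Proof.
move=> /L2P[mf rf] /L2P[mg rg].
apply: (L2_le (cmeasD mf mg) (rintD (rintZ 2 rf) (rintZ 2 rg))) => x.
exact: nc2D2.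
Qed.

Lemma L2Z z f : L2 f -> L2 (fun x => z * f x).
Proof.
move=> /L2P[mf rf]; apply: (L2_le _ (rintZ (nc z ^+ 2) rf)) => [|x].
  by apply: cmeasM => //; exact: cmeas_cst.
by rewrite ncM exprMn.
Qed.

Lemma L2B f g : L2 f -> L2 g -> L2 (fun x => f x - g x).
Proof.
move=> Lf Lg; rewrite (_ : (fun x => f x - g x) = fun x => f x + -1 * g x).
  by apply: L2D => //; exact: L2Z.
by apply/funext => x; rewrite mulN1r.
Qed.

Lemma n2Z z f : L2 f -> n2 (fun x => z * f x) = nc z ^+ 2 * n2 f.
Proof.
move=> /L2_rint rf; rewrite /n2 -RintegralZT //.
by apply: eq_Rintegral => x _; rewrite ncM exprMn.
Qed.

Lemma n2C f g : n2 (fun x => f x - g x) = n2 (fun x => g x - f x).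
Proof. by apply: eq_Rintegral => x _; rewrite -ncN opprB. Qed.

Lemma n2D d f g : 0 < d -> L2 f -> L2 g ->
  n2 (fun x => f x + g x) <= (1 + d) * n2 f + (1 + d^-1) * n2 g.
Proof.
move=> d0 /L2P[mf rf] /L2P[mg rg].
rewrite /n2 -!RintegralZT // -RintegralDT; [|exact: rintZ..].
apply: (n2_le (cmeasD mf mg)); first by apply: rintD; exact: rintZ.
by move=> x; exact: nc2D.
Qed.

Lemma n2B f g h : L2 f -> L2 g -> L2 h ->
  n2 (fun x => f x - h x) <= 2 * n2 (fun x => f x - g x) + 2 * n2 (fun x => g x - h x).
Proof.
move=> Lf Lg Lh; have := n2D ltr01 (L2B Lf Lg) (L2B Lg Lh).
rewrite invr1; apply: le_trans.
rewrite le_eqVlt; apply/orP; left; apply/eqP.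
by apply: eq_Rintegral => x _; rewrite addrA subrK.
Qed.

Lemma L2_schwartz s : schwartz s -> L2 s.
Proof.
move=> ss; have [C C0 sC] := rapid_decay (schwartz_rapid ss).
apply: (L2_le (schwartz_cmeas ss) (rint_decay (C * C))) => x.
have le1 : (1 + x ^+ 2)^-1 <= 1.
  by rewrite invf_le1 ?lerDl ?sqr_ge0 // ltr_pwDl ?sqr_ge0.
have ge0 : 0 <= (1 + x ^+ 2)^-1 by rewrite invr_ge0 addr_ge0 ?sqr_ge0.
apply: le_trans (_ : (C * (1 + x ^+ 2)^-1) ^+ 2 <= _).
  by rewrite lerXn2r ?nnegrE ?nc_ge0 ?mulr_ge0.
by rewrite exprMn -expr2 ler_wpM2l ?sqr_ge0 // expr2 ler_piMr.
Qed.

Lemma n2_ae f g : L2 f -> L2 g -> L2eq f g -> n2 f = n2 g.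
Proof.
move=> /L2_cmeas mf /L2_cmeas mg fg; rewrite /n2 /Rintegral; congr fine.
apply: ae_eq_integral => //.
- by apply/measurable_EFinP; exact: measurable_nc2.
- by apply/measurable_EFinP; exact: measurable_nc2.
- by apply: ae_imp fg => x /= -> _.
Qed.

Lemma n2_eq0 f : L2 f -> n2 f = 0 -> L2eq f (fun=> 0).
Proof.
move=> /L2P[mf rf] f0.
have : (\int[leb]_x `|(nc (f x) ^+ 2)%:E| = 0)%E.
  under eq_integral do rewrite gee0_abs ?lee_fin ?sqr_ge0 //.
  by rewrite -(fineK (integrable_fin_num measurableT rf)) -/(Rintegral _ _ _) -/(n2 f) f0.
have mE : measurable_fun setT (fun x => (nc (f x) ^+ 2)%:E).
  by apply/measurable_EFinP; exact: measurable_nc2.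
move=> /(ae_eq_integral_abs leb measurableT mE).
by apply: ae_imp => x /= /(_ I)/eqP; rewrite eqe sqrf_eq0 => /eqP/nc_eq0.
Qed.

Lemma L2_dct (f_ : nat -> R -> R[i]) f G :
  (forall n, cmeas (f_ n)) -> (forall x, ccvg (f_ ^~ x) (f x)) ->
  rint (fun x => G x ^+ 2) -> (forall n x, nc (f_ n x) <= G x) ->
  L2 f /\ n2 (fun x => f x - f_ n x) @[n --> \oo] --> (0 : R).
Proof.
move=> mf cf rG fG.
have mlim : cmeas f.
  split.
    apply: (measurable_fun_cvg (h := fun n => re \o f_ n)).
      by move=> n; have [] := mf n.
    by move=> x _; have [] := cf x.
  apply: (measurable_fun_cvg (h := fun n => im \o f_ n)).
    by move=> n; have [] := mf n.
  by move=> x _; have [] := cf x.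
have sqle n x : nc (f_ n x) ^+ 2 <= G x ^+ 2.
  by rewrite lerXn2r ?nnegrE ?nc_ge0 // (le_trans (nc_ge0 _) (fG n x)).
have c2 x : nc (f x - f_ n x) ^+ 2 @[n --> \oo] --> (0 : R).
  have [cr ci] := cf x.
  rewrite (_ : (fun n => _) = fun n => (re (f x) - re (f_ n x)) ^+ 2 +
      (im (f x) - im (f_ n x)) ^+ 2); last first.
    by apply/funext => n; rewrite sqr_nc reD imD reN imN.
  rewrite -[X in _ --> X]addr0 -[X in _ --> X + _](expr0n R 2) -[X in _ --> _ + X](expr0n R 2).
  apply: cvgD; rewrite !expr2; under eq_fun do rewrite expr2.
    by apply: cvgM; rewrite -(subrr (re (f x))); apply: cvgB => //; exact: cvg_cst.
  by apply: cvgM; rewrite -(subrr (im (f x))); apply: cvgB => //; exact: cvg_cst.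
(* Obtained as the limit of [2 |f - f_n|^2 + 2 G^2]. *)
have sqf x : nc (f x) ^+ 2 <= 2 * G x ^+ 2.
  rewrite -[leRHS]add0r -(mulr0 2).
  apply: (cvgr_to_ge (f := fun n => 2 * nc (f x - f_ n x) ^+ 2 + 2 * G x ^+ 2) (F := \oo)).
    by apply: cvgD; [apply: cvgM => //; exact: cvg_cst|exact: cvg_cst].
  near=> n; apply: le_trans (_ : 2 * nc (f x - f_ n x) ^+ 2 + 2 * nc (f_ n x) ^+ 2 <= _).
    by apply: le_trans (nc2D2 _ _); rewrite subrK.
  by rewrite lerD2l ler_pM2l.
split; first by apply: (L2_le mlim (rintZ 2 rG)).
rewrite -[X in _ --> X](_ : \int[leb]_x (0 : R) = 0); last by rewrite Rintegral_cst // mul0r.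
have r6 := rintZ 6 rG.
(* The 6 is [2 * 2 + 2], from the bounds [2 G^2] on the limit and [G^2] on the sequence. *)
refine (proj2 (Rintegral_dct (f := fun=> 0) (G := fun x => 6 * G x ^+ 2) _ c2 r6 _)).
- move=> n; apply: measurable_nc2; apply: cmeasD => //.
  rewrite (_ : (fun x => - f_ n x) = fun x => -1 * f_ n x).
    by apply: cmeasM => //; exact: cmeas_cst.
  by apply/funext => x; rewrite mulN1r.
- move=> n x; rewrite ger0_norm ?sqr_ge0 //.
  apply: le_trans (nc2D2 _ _) _; rewrite ncN.
  have := sqle n x; have := sqf x; lra.
Unshelve. all: end_near. Qed.

(** The L2 closure of the Schwartz functions. *)
Definition approx f : Prop := L2 f /\
  forall eps : R, 0 < eps -> exists2 s, schwartz s & n2 (fun x => f x - s x) < eps.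

Lemma approx_schwartz s : schwartz s -> approx s.
Proof.
move=> ss; split; first exact: L2_schwartz.
move=> eps e0; exists s => //; rewrite (_ : n2 _ = 0) //.
rewrite (_ : (fun x => s x - s x) = fun=> 0); last by apply/funext => x; rewrite subrr.
by rewrite /n2 ComplexField.Normc.normc0 expr0n Rintegral_cst // mul0r.
Qed.

Lemma approx_lim f : L2 f ->
  (forall eps : R, 0 < eps -> exists2 g, approx g & n2 (fun x => f x - g x) < eps) ->
  approx f.
Proof.
move=> Lf fg; split=> // eps e0.
have e4 : 0 < eps / 4 by rewrite divr_gt0.
have [g [Lg ag] fge] := fg _ e4; have [s ss gs] := ag _ e4.
exists s => //; apply: le_lt_trans (n2B Lf Lg (L2_schwartz ss)) _.
by lra.
Qed.

Lemma approx_lin z f g : approx f -> approx g -> approx (fun x => z * f x + g x).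
Proof.
move=> [Lf af] [Lg ag]; split; first by apply: L2D => //; exact: L2Z.
move=> eps e0.
have K0 : 0 < 2 * nc z ^+ 2 + 2.
  by have := sqr_ge0 (nc z); lra.
have e1 : 0 < eps / (2 * nc z ^+ 2 + 2) by rewrite divr_gt0.
have [s ss fs] := af _ e1; have [u su gu] := ag _ e1.
exists (fun x => z * s x + u x); first exact: schwartz_lin.
have Lfs := L2B Lf (L2_schwartz ss); have Lgu := L2B Lg (L2_schwartz su).
apply: le_lt_trans (_ : 2 * (nc z ^+ 2 * n2 (fun x => f x - s x)) +
    2 * n2 (fun x => g x - u x) < _).
  rewrite -n2Z //; have := n2D ltr01 (L2Z z Lfs) Lgu.
  rewrite invr1; apply: le_trans.
  rewrite le_eqVlt; apply/orP; left; apply/eqP.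
  by apply: eq_Rintegral => x _; congr (nc _ ^+ 2); ring.
have z0 := sqr_ge0 (nc z).
have h1 := ler_wpM2l z0 (ltW fs).
apply: lt_le_trans (_ : 2 * (nc z ^+ 2 * (eps / (2 * nc z ^+ 2 + 2))) +
   2 * (eps / (2 * nc z ^+ 2 + 2)) <= _); first by lra.
rewrite le_eqVlt; apply/orP; left; apply/eqP.
by field; rewrite gt_eqF.
Qed.

Lemma approx_dct (f_ : nat -> R -> R[i]) f G :
  (forall n, approx (f_ n)) -> (forall x, ccvg (f_ ^~ x) (f x)) ->
  rint (fun x => G x ^+ 2) -> (forall n x, nc (f_ n x) <= G x) -> approx f.
Proof.
move=> af cf rG fG.
have [Lf lim] := L2_dct (fun n => L2_cmeas (proj1 (af n))) cf rG fG.
apply: approx_lim => // eps e0.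
have [n _ hn] : \forall n \near \oo, n2 (fun x => f x - f_ n x) < eps by exact: (cvgr_lt 0).
by exists (f_ n) => //; exact: (hn n (leqnn n)).
Qed.

End SquareIntegrable.

(** * Density of Schwartz functions in L2 *)

Section Density.
Import HBNNSimple.
Context {R : realType}.
Implicit Types (f g h s : R -> R[i]) (G : R -> R) (t x y c r : R) (z w : R[i]) (A B : set R).
Local Notation re := (@complex.Re R).
Local Notation im := (@complex.Im R).
Local Notation nc := (@ComplexField.Normc.normc R).
Local Notation leb := (@lebesgue_measure R).

Lemma cvg_flat_bump (v : R) : 0 <= v ->
  expR (- v ^+ n.+1) @[n --> \oo] -->
    (if v < 1 then 1 else if v == 1 then expR (-1) else 0 : R).
Proof.
move=> v0; case: ltgtP => [v1|v1|->]; last first.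
- by under eq_fun do rewrite expr1n; exact: cvg_cst.
- have w1 : `|v^-1| < 1 by rewrite ger0_norm ?invr_ge0 // invf_lt1 // (lt_trans ltr01).
  apply: (@squeeze_cvgr _ _ _ _ (fun=> 0) (fun n => v^-1 ^+ n.+1)).
  + apply/nearW => n; rewrite expR_ge0 /= expRN exprVn lef_pV2 ?posrE ?expR_gt0 //.
      by apply: le_trans (expR_ge1Dx _); rewrite lerDr.
    by rewrite exprn_gt0 // (lt_trans ltr01).
  + exact: cvg_cst.
  + by have := cvg_expr w1; rewrite -(cvg_shiftS (GRing.exp v^-1)).
- have w1 : `|v| < 1 by rewrite ger0_norm.
  rewrite -[X in _ --> X]expR0; apply: cvg_seq_expR.
  rewrite -[X in _ --> X]oppr0; apply: cvgN.
  by have := cvg_expr w1; rewrite -(cvg_shiftS (GRing.exp v)).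
Qed.

(** The pointwise limit of the flat bumps keeps the value [1 / e] at the two endpoints; [approx_itv]
    removes it by letting the radius increase to its limit from below. *)
Lemma approx_ball_closed c r : 0 < r -> approx (fun x =>
  (if ((x - c) / r) ^+ 2 < 1 then 1 else
    if ((x - c) / r) ^+ 2 == 1 then expR (-1) else 0)%:C : R[i]).
Proof.
move=> r0; pose v (x : R) : R := ((x - c) / r) ^+ 2.
have v0 x : 0 <= v x by exact: sqr_ge0.
(* A lower bound independent of [n]; it yields both the Gaussian majorant of the bumps and the
   quadratic growth that makes them Schwartz. *)
have vn n x : v x - 1 <= v x ^+ n.+1.
  have [v1|v1] := leP 1 (v x).
    by apply: le_trans (_ : v x <= _); [rewrite gerBl|exact: ler_eXnr].
  by apply: le_trans (_ : 0 <= _); [rewrite subr_le0 ltW|rewrite exprn_ge0].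
apply: (@approx_dct _ (fun n x => (expR (- v x ^+ n.+1))%:C) _
  (fun x => expR 1 * expR (- v x))).
- move=> n; apply: approx_schwartz.
  pose p : {poly R} := (((r^-1)%:P * ('X - c%:P)) ^+ 2) ^+ n.+1.
  have pE x : p.[x] = v x ^+ n.+1 by rewrite /p /v !hornerE mulrC.
  have := @schwartz_poly_expR _ 1 p (2^-1 * (r ^- 2)) (1 + c ^+ 2 / r ^+ 2).
  rewrite mulr_gt0 ?invr_gt0 ?exprn_gt0 // => /(_ isT).
  rewrite (_ : (fun x => _) = fun x => (expR (- v x ^+ n.+1))%:C).
    apply=> x; rewrite pE; apply: le_trans (vn n x).
    rewrite -subr_ge0 (_ : _ - _ = r ^- 2 * ((x - 2 * c) ^+ 2 / 2)).
      by rewrite mulr_ge0 ?invr_ge0 ?exprn_ge0 ?divr_ge0 ?sqr_ge0 // ltW.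
    by rewrite /v; field; rewrite gt_eqF.
  by apply/funext => x; rewrite hornerC mul1r pE.
- by move=> x; apply: ccvg_real; exact: cvg_flat_bump.
- have k0 : 0 < 2 / r ^+ 2 by rewrite divr_gt0 ?exprn_gt0.
  rewrite (_ : (fun x => _) = fun x => expR 1 ^+ 2 * expR (- (2 / r ^+ 2 * (x - c) ^+ 2))).
    by apply: rintZ; exact: (Rintegral_gauss c k0).1.
  apply/funext => x; rewrite exprMn; congr (_ * _).
  by rewrite -expRM_natl /v; congr expR; field; rewrite gt_eqF.
- move=> n x; rewrite nc_real ger0_norm ?expR_ge0 // -expRD ler_expR.
  by have := vn n x; lra.
Qed.

Lemma rint_indic_itv a b : rint (\1_(`]a, b[%classic) : R -> R).
Proof.
exact: integrable_indic_itv.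
Qed.

Lemma approx_itv (a b : R) : approx (fun x => (\1_(`]a, b[%classic) x)%:C).
Proof.
have [ab|ba] := ltP a b; last first.
  rewrite (_ : (fun x => _) = fun=> 0); first exact/approx_schwartz/schwartz0.
  apply/funext => x; rewrite indicE memNset // /= in_itv /= => /andP[ax xb].
  by move: (lt_trans ax xb); rewrite ltNge ba.
pose c := (a + b) / 2; pose r := (b - a) / 2.
have r0 : 0 < r by rewrite divr_gt0 // subr_gt0.
(* The shift by 2 keeps even the first radius positive. *)
pose rn n : R := r * (1 - n.+2%:R^-1).
have nV n : 0 < (n.+2%:R)^-1 :> R by rewrite invr_gt0.
have nV1 n : (n.+2%:R)^-1 < 1 :> R by rewrite invf_lt1 // ltr1n.
have rn0 n : 0 < rn n by rewrite mulr_gt0 // subr_gt0.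
have rnr n : rn n < r by rewrite gtr_pMr // gtrBl.
have inE' x : (x \in `]a, b[) = (`|x - c| < r).
  by rewrite in_itv /= ltr_distl /c /r; apply/idP/idP => /andP[h1 h2]; apply/andP; split; lra.
have sqE x n : (((x - c) / rn n) ^+ 2 < 1) = (`|x - c| < rn n).
  rewrite expr_div_n ltr_pdivrMr ?exprn_gt0 // mul1r -real_normK ?num_real //.
  by rewrite ltr_sqr ?nnegrE // ltW.
have sqE1 x n : (((x - c) / rn n) ^+ 2 == 1) = (`|x - c| == rn n).
  have n0 : rn n ^+ 2 != 0 by rewrite gt_eqF // exprn_gt0.
  rewrite expr_div_n (can2_eq (divfK n0) (mulfK n0)) mul1r -real_normK ?num_real //.
  by rewrite eqrXn2 // ltW.
apply: (@approx_dct _ (fun n x => (if ((x - c) / rn n) ^+ 2 < 1 then 1 else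
    if ((x - c) / rn n) ^+ 2 == 1 then expR (-1) else 0)%:C) _ (\1_(`]a, b[%classic))).
- by move=> n; exact: approx_ball_closed.
- move=> x; apply: ccvg_real; rewrite indicE.
  have [xI|xI] := boolP (x \in `]a, b[); last first.
    rewrite memNset; last by apply/negP.
    apply: cvg_near_cst; apply: nearW => n; rewrite sqE sqE1.
    move: xI; rewrite inE' -leNgt => xr.
    have h := lt_le_trans (rnr n) xr.
    by rewrite ltNge (ltW h) /= gt_eqF.
  rewrite mem_set //; apply: cvg_near_cst.
  move: xI; rewrite inE' => xr.
  have lim : rn n @[n --> \oo] --> r.
    rewrite -[X in _ --> X]mulr1; apply: cvgM; first exact: cvg_cst.
    rewrite -[X in _ --> X]subr0; apply: cvgB; first exact: cvg_cst.
    by have := @cvg_harmonic R; rewrite -(cvg_shiftS (fun n => n.+1%:R^-1 : R)).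
  near=> n; rewrite sqE ifT //; near: n.
  exact: (cvgr_gt r).
- have := rint_indic_itv a b; congr rint; apply/funext => x.
  by rewrite indicE; case: (_ \in _); rewrite ?expr1n ?expr0n.
- move=> n x; rewrite nc_real indicE sqE sqE1.
  have [xI|xI] := boolP (x \in `]a, b[); last first.
    rewrite memNset; last by apply/negP.
    move: xI; rewrite inE' -leNgt => xr.
    have h := lt_le_trans (rnr n) xr.
    by rewrite ltNge (ltW h) /= gt_eqF // normr0.
  rewrite mem_set //; case: ifP => _; first by rewrite normr1.
  case: ifP => _; rewrite ?normr0 //.
  by rewrite ger0_norm ?expR_ge0 //= -[leRHS]expR0 ler_expR lerN10.
Unshelve. all: end_near. Qed.

(** The bounded cut keeps indicators square-integrable when passing to complements, so that the
    Dynkin class contains the whole line. *)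
Definition window n : set R := `]- n.+1%:R, n.+1%:R[%classic.

Definition approx_set n A := approx (fun x => (\1_(A `&` window n) x)%:C : R[i]).

Lemma approx_setU n A B : A `&` B = set0 -> approx_set n A -> approx_set n B ->
  approx_set n (A `|` B).
Proof.
move=> AB aA aB; have := approx_lin 1 aA aB; congr approx; apply/funext => x.
rewrite mul1r -rmorphD /=; congr (_%:C); rewrite !indicE !in_setI in_setU.
have := in_setI x A B; rewrite AB in_set0.
by case: (x \in A); case: (x \in B); case: (x \in window n) => //= _; rewrite ?addr0 ?add0r.
Qed.

(** Open rays generate the measurable sets, are stable under intersection, and meet the window in
    open intervals. Complements are differences with the window, and countable disjoint unions are
    limits dominated by its indicator. *)
Lemma approx_setP n A : measurable A -> approx_set n A.
Proof.
have aI : approx_set n setT by rewrite /approx_set setTI; exact: approx_itv.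
have mE : @measurable _ (measurableTypeR R) = <<s RGenOInfty.G (R := R) >>.
  exact: RGenOInfty.measurableE.
move=> mA; apply: (@dynkin_induction _ (measurableTypeR R) (RGenOInfty.G (R := R))
  (approx_set n) mE) => //.
- move=> _ _ [x ->] [y ->]; exists (Num.max x y); apply/seteqP; split=> u /=.
    by rewrite !in_itv /= !andbT gt_max => -[-> ->].
  by rewrite !in_itv /= !andbT gt_max => /andP[-> ->].
- move=> _ [x ->]; rewrite /approx_set.
  rewrite (_ : _ `&` window n = `](Num.max x (- n.+1%:R)), n.+1%:R[%classic); first exact: approx_itv.
  apply/seteqP; split=> u; rewrite /window /= !in_itv /= ?andbT gt_max.
    by move=> [xu /andP[nu un]]; rewrite xu nu un.
  by move=> /andP[/andP[xu nu] un]; rewrite xu nu un.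
- move=> S _ aS; have := approx_lin (-1) aS aI; congr approx; apply/funext => x.
  rewrite mulN1r addrC -rmorphB /=; congr (_%:C).
  rewrite !indicE !in_setI in_setC in_setT.
  by case: (x \in S); case: (x \in window n) => /=; rewrite ?subr0 ?subrr.
- move=> F mF tF aF.
  pose U N := \big[setU/set0]_(i < N) F i.
  have aU N : approx_set n (U N).
    elim: N => [|N IH].
      rewrite /U big_ord0 /approx_set set0I.
      have := approx_schwartz (@schwartz0 R); congr approx.
      by apply/funext => x; rewrite indic0.
    rewrite /U big_ord_recr; apply: approx_setU => //.
    by apply: (@trivIset_bigsetUI _ xpredT F) => //; apply: sub_trivIset tF.
  apply: (approx_dct (f_ := fun N x => (\1_(U N `&` window n) x)%:C)
    (G := \1_(window n))) => //.
  + move=> x; apply: ccvg_real; apply: cvg_near_cst.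
    have [[k _ Fkx]|nF] := pselect ((\bigcup_k F k) x).
      near=> N; rewrite !indicE !in_setI; congr (nat_of_bool (_ && _))%:R.
      rewrite !mem_set //; first by exists k.
      rewrite /U -bigcup_mkord; exists k => //=.
      by near: N; exact: nbhs_infty_gt.
    apply: nearW => N; rewrite !indicE !in_setI; congr (nat_of_bool (_ && _))%:R.
    have nU : ~ U N x by rewrite /U -bigcup_mkord => -[k _ Fkx]; apply: nF; exists k.
    by rewrite !memNset.
  + have := rint_indic_itv (- n.+1%:R) n.+1%:R; congr rint; apply/funext => x.
    by rewrite /window indicE; case: (_ \in _); rewrite ?expr1n ?expr0n.
  + move=> N x; rewrite nc_real !indicE in_setI.
    by case: (_ \in U N); case: (_ \in window n); rewrite /= ?normr1 ?normr0.
- by rewrite -mE.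
Unshelve. all: end_near. Qed.

Lemma approx_sum N (z : 'I_N -> R[i]) (f : 'I_N -> R -> R[i]) :
  (forall i, approx (f i)) -> approx (fun x => \sum_(i < N) z i * f i x).
Proof.
elim: N z f => [|N IH] z f af.
  have := approx_schwartz (@schwartz0 R); congr approx.
  by apply/funext => x; rewrite big_ord0.
have := approx_lin (z ord_max) (af ord_max)
  (IH (fun i => z (widen_ord (leqnSn N) i)) (fun i => f (widen_ord (leqnSn N) i)) (fun i => af _)).
by congr approx; apply/funext => x; rewrite big_ord_recr addrC.
Qed.

(** Simple functions increase to [g]. Cut by the growing windows they are combinations of indicators
    from [approx_setP], and [g] itself dominates them. *)
Lemma approx_ge0 (g : R -> R) : measurable_fun setT g -> (forall x, 0 <= g x) ->
  rint (fun x => g x ^+ 2) -> approx (fun x => (g x)%:C).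
Proof.
move=> mg g0 rg.
have mE : measurable_fun setT (EFin \o g) by exact/measurable_EFinP.
pose phi := nnsfun_approx measurableT mE.
have g0E x : setT x -> (0 <= (EFin \o g) x)%E by move=> _; rewrite lee_fin.
have cphi x : phi n x @[n --> \oo] --> g x.
  by have := cvg_nnsfun_approx measurableT mE g0E (I : setT x); move/fine_cvg.
have phile n x : phi n x <= g x.
  apply: (cvgr_to_ge (cphi x)); near=> m.
  have nm : (n <= m)%N by near: m; exact: nbhs_infty_ge.
  by have /lefP := nd_nnsfun_approx measurableT mE nm; exact.
apply: (@approx_dct _ (fun n x => (phi n x * \1_(window n) x)%:C) _ g) => //.
- move=> n; pose s := fset_set (phi n @` setT).
  have := @approx_sum _ (fun i : 'I_(#|`s|) => (s`_i)%:C)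
    (fun i x => (\1_(phi n @^-1` [set s`_i] `&` window n) x)%:C).
  rewrite (_ : (fun x => _) = fun x => (phi n x * \1_(window n) x)%:C).
    by apply=> i; apply: approx_setP; exact: measurable_sfunP.
  apply/funext => x; rewrite [in RHS]fimfunEord -/s mulr_suml rmorph_sum /=.
  apply: eq_bigr => i _; rewrite -rmorphM -mulrA; congr ((_ * _)%:C).
  by rewrite !indicE in_setI -mulnb natrM.
- move=> x; apply: ccvg_real; rewrite -[X in _ --> X]mulr1; apply: cvgM => //.
  apply: cvg_near_cst; near=> n; rewrite indicE mem_set // /window /= in_itv /= -ltr_norml.
  have : `|x| <= n%:R by near: n; exact: nbhs_infty_ger.
  by move=> h; apply: le_lt_trans h _; rewrite ltr_nat.
- move=> n x; rewrite nc_real indicE; case: (_ \in _); rewrite /= ?mulr0 ?normr0 // mulr1.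
  by rewrite ger0_norm.
Unshelve. all: end_near. Qed.

Theorem schwartz_dense f : L2 f -> approx f.
Proof.
move=> Lf; have [mr mi] := L2_cmeas Lf; have rf := L2_rint Lf.
(* The positive part of [u] for [b = false], the negative part for [b = true]. *)
have half (u : R -> R) (b : bool) : measurable_fun setT u -> (forall x, `|u x| <= nc (f x)) ->
    approx (fun x => ((`|u x| + (-1) ^+ b * u x) / 2)%:C).
  move=> mu uf.
  have mb : measurable_fun setT (fun x => (`|u x| + (-1) ^+ b * u x) / 2).
    apply: measurable_funM => //; apply: measurable_funD; first exact: measurableT_comp.
    by apply: measurable_funM.
  have sgnb (v : R) : (-1) ^+ b * v <= `|v| /\ - `|v| <= (-1) ^+ b * v.
    have : `|(-1) ^+ b * v| <= `|v| by rewrite normrMsign.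
    by rewrite ler_norml => /andP[].
  have b0 x : 0 <= (`|u x| + (-1) ^+ b * u x) / 2.
    by rewrite divr_ge0 //; have [] := sgnb (u x); lra.
  have bf x : (`|u x| + (-1) ^+ b * u x) / 2 <= nc (f x).
    by apply: le_trans (uf x); have [] := sgnb (u x); lra.
  apply: approx_ge0 => //; apply: (rint_le _ _ rf) => [|x]; first exact: measurable_funX.
  by rewrite ger0_norm ?sqr_ge0 // lerXn2r ?nnegrE ?nc_ge0.
have ar b := half (re \o f) b mr (fun x => le_re_nc _).
have ai b := half (im \o f) b mi (fun x => le_im_nc _).
have := approx_lin 'i (approx_lin (-1) (ai true) (ai false)) (approx_lin (-1) (ar true) (ar false)).
by congr approx; apply/funext => x; apply: complex_eq;
  rewrite !reimE /= ?expr1 ?expr0; field.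
Qed.

End Density.

(** * Completeness of L2 *)

Section Completeness.
Context {R : realType}.
Implicit Types (f g h s : R -> R[i]) (x : R) (z w : R[i]).
Local Notation re := (@complex.Re R).
Local Notation im := (@complex.Im R).
Local Notation nc := (@ComplexField.Normc.normc R).
Local Notation leb := (@lebesgue_measure R).

Lemma cvgn_of_sqr_bound (w : nat -> R) (C : R) :
  (forall n k, 2 ^+ n * (w (n + k)%N - w n) ^+ 2 <= C) -> cvgn w.
Proof.
move=> wC; apply/cauchy_cvgP; apply: cauchy_exP => eps e0.
have C1 : 0 < (C + 1) / eps ^+ 2.
  rewrite divr_gt0 ?exprn_gt0 // ltr_wpDl // (le_trans _ (wC 0%N 0%N)) //.
  by rewrite mulr_ge0 ?sqr_ge0.
have [n hn] : exists n : nat, (C + 1) / eps ^+ 2 <= n%:R.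
  have [n _ hn] := @nbhs_infty_ger R ((C + 1) / eps ^+ 2).
  by exists n; exact: hn (leqnn n).
exists (w n); rewrite /nbhs /=; near=> M.
have nM : (n <= M)%N by near: M; exact: nbhs_infty_ge.
rewrite /ball /=; have := wC n (M - n)%N; rewrite subnKC // => h.
rewrite distrC -ltr_sqr ?nnegrE ?normr_ge0 ?ltW // real_normK ?num_real //.
have n2 : n%:R <= 2 ^+ n :> R by rewrite -natrX ler_nat ltnW // ltn_expl.
have e2 : 0 < eps ^+ 2 by rewrite exprn_gt0.
have h1 : C + 1 <= 2 ^+ n * eps ^+ 2.
  by rewrite -ler_pdivrMr //; exact: le_trans hn n2.
have p0 : 0 < 2 ^+ n :> R by rewrite exprn_gt0.
by rewrite -(ltr_pM2l p0); lra.
Unshelve. all: end_near. Qed.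

(* Iterating [|z + w|^2 <= 2 |z|^2 + 2 |w|^2] along the telescoping sum costs a
   factor 2 at each step, which the weights [2 ^+ m] absorb. *)
Lemma telescope_nc2 (u : nat -> R[i]) n k :
  2 ^+ n * nc (u (n + k)%N - u n) ^+ 2 <=
  2 * (\sum_(0 <= m < n + k) 2 ^+ m * nc (u m.+1 - u m) ^+ 2 -
       \sum_(0 <= m < n) 2 ^+ m * nc (u m.+1 - u m) ^+ 2).
Proof.
elim: k n => [|k IH] n.
  by rewrite addn0 !subrr ComplexField.Normc.normc0 expr0n !mulr0.
have := IH n.+1; rewrite addSnnS.
set P := \sum_(0 <= m < n + k.+1) _; rewrite big_nat_recr //=.
set Q := \sum_(0 <= m < n) _ => h.
have h2 : nc (u (n + k.+1)%N - u n) ^+ 2 <=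
    2 * nc (u (n + k.+1)%N - u n.+1) ^+ 2 + 2 * nc (u n.+1 - u n) ^+ 2.
  by apply: le_trans (nc2D2 _ _); rewrite addrA subrK.
have p0 : 0 <= 2 ^+ n :> R by rewrite exprn_ge0.
have := ler_wpM2l p0 h2; rewrite exprS in h; lra.
Qed.

(** The weighted series [S] of squared increments has integral at most the sum of [2^m 4^-m], that
    is 2, hence is finite almost everywhere. There the telescoping bound makes the sequence Cauchy,
    with squared error at most [2 S / 2^n], whose integral is at most [4 / 2^n]. *)
Lemma L2_complete (u : nat -> R -> R[i]) : (forall n, L2 (u n)) ->
  (forall n, n2 (fun x => u n.+1 x - u n x) <= (4^-1) ^+ n) ->
  exists2 g, L2 g & forall n, n2 (fun x => g x - u n x) <= 4 / 2 ^+ n.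
Proof.
move=> Lu du.
pose a m x := 2 ^+ m * nc (u m.+1 x - u m x) ^+ 2.
have Ld m : L2 (fun x => u m.+1 x - u m x) by exact: L2B.
have a0 m x : 0 <= a m x by rewrite mulr_ge0 ?sqr_ge0 ?exprn_ge0.
have ra m : rint (a m) by apply: rintZ; exact: L2_rint.
have ma m : measurable_fun setT (a m) by exact: rint_measurable.
have aE0 m x : (0 <= (a m x)%:E)%E by rewrite lee_fin.
pose S x : \bar R := (\sum_(0 <= m <oo) (a m x)%:E)%E.
have mS : measurable_fun setT S.
  apply: (@ge0_emeasurable_sum _ _ _ setT (fun m x => (a m x)%:E) xpredT) => // m _.
  exact/measurable_EFinP.
have S0 x : (0 <= S x)%E by exact: nneseries_ge0.
have IS : (\int[leb]_x S x <= 2%:E)%E.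
  have mE m : measurable_fun setT (fun x => (a m x)%:E) by exact/measurable_EFinP.
  rewrite (integral_nneseries leb measurableT mE (fun m x _ => aE0 m x)).
  apply: lime_le.
    by apply: is_cvg_nneseries => m _ _; apply: integral_ge0 => x _; exact: aE0.
  apply: nearW => N.
  have sN : \sum_(0 <= m < N) (2^-1) ^+ m <= 2 - 2 * 2^-1 ^+ N :> R.
    elim: N => [|N IH]; first by rewrite big_nil expr0; lra.
    by rewrite big_nat_recr //= exprS; lra.
  apply: le_trans (_ : ((\sum_(0 <= m < N) (2^-1) ^+ m)%:E <= _)%E); last first.
    rewrite lee_fin; apply: le_trans sN _.
    by rewrite gerBl mulr_ge0 // exprn_ge0.
  rewrite -sumEFin; apply: lee_sum => m _.
  rewrite -(fineK (integrable_fin_num measurableT (ra m))) lee_fin.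
  rewrite -/(Rintegral leb setT (a m)) RintegralZT; last exact: L2_rint.
  apply: le_trans (ler_wpM2l _ (du m)) _; first by rewrite exprn_ge0.
  rewrite -exprMn le_eqVlt; apply/orP; left; apply/eqP.
  by congr (_ ^+ _); field.
have iS : leb.-integrable setT S.
  apply/integrableP; split=> //; under eq_integral do rewrite gee0_abs //.
  by apply: le_lt_trans IS _; rewrite ltry.
pose A := [set x | S x \is a fin_num].
have mA : measurable A.
  by have := emeasurable_fin_num measurableT mS; rewrite setTI.
(* Cutting to the set where [S] is finite gives convergence at every point and changes the sequence
   only on a null set. *)
pose c x : R := \1_A x.
have mc : cmeas (fun x => (c x)%:C).
  split; last exact: measurable_cst.
  by rewrite (_ : re \o _ = \1_A) //; exact: measurable_indic.
pose v n x := (c x)%:C * u n x.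
have mv n : cmeas (v n) by apply: cmeasM => //; exact: L2_cmeas.
have bound n k x : 2 ^+ n * nc (v (n + k)%N x - v n x) ^+ 2 <= 2 * fine (S x).
  rewrite /v -mulrBr ncM nc_real exprMn /c indicE.
  have [xA|xA] := boolP (x \in A); last first.
    rewrite normr0 expr0n /= mul0r mulr0 mulr_ge0 //; exact: fine_ge0.
  rewrite normr1 expr1n mul1r.
  apply: le_trans (telescope_nc2 (fun m => u m x) n k) _.
  rewrite ler_wpM2l // lerBlDr ler_wpDr //.
    by rewrite sumr_ge0 // => m _; exact: a0.
  rewrite -lee_fin fineK; last by move: xA; rewrite inE.
  rewrite -sumEFin; exact: (nneseries_lim_ge (u_ := fun m => (a m x)%:E)).
have cre x : cvgn (fun n => re (v n x)).
  apply: (@cvgn_of_sqr_bound _ (2 * fine (S x))) => n k; apply: le_trans (bound n k x).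
  by rewrite ler_wpM2l ?exprn_ge0 // sqr_nc reD reN lerDl sqr_ge0.
have cim x : cvgn (fun n => im (v n x)).
  apply: (@cvgn_of_sqr_bound _ (2 * fine (S x))) => n k; apply: le_trans (bound n k x).
  by rewrite ler_wpM2l ?exprn_ge0 // sqr_nc imD imN lerDr sqr_ge0.
pose g x : R[i] := limn (fun n => re (v n x)) +i* limn (fun n => im (v n x)).
have cg x : ccvg (v ^~ x) (g x) by split; [exact: cre|exact: cim].
have mg : cmeas g.
  split.
    apply: (measurable_fun_cvg (h := fun n => re \o v n)).
      by move=> n; have [] := mv n.
    by move=> x _; have [] := cg x.
  apply: (measurable_fun_cvg (h := fun n => im \o v n)).
    by move=> n; have [] := mv n.
  by move=> x _; have [] := cg x.
have gbound n x : nc (g x - v n x) ^+ 2 <= 2 / 2 ^+ n * fine (S x).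
  rewrite mulrAC ler_pdivlMr ?exprn_gt0 // mulrC.
  have [cr ci] := cg x.
  have lim : 2 ^+ n * nc (v (n + k)%N x - v n x) ^+ 2 @[k --> \oo] -->
      2 ^+ n * nc (g x - v n x) ^+ 2.
    apply: cvgM; first exact: cvg_cst.
    rewrite (_ : (fun k => _) = fun k => (re (v (k + n)%N x) - re (v n x)) *
        (re (v (k + n)%N x) - re (v n x)) +
        (im (v (k + n)%N x) - im (v n x)) * (im (v (k + n)%N x) - im (v n x))); last first.
      by apply/funext => k; rewrite addnC sqr_nc reD imD reN imN !expr2.
    rewrite sqr_nc reD imD reN imN !expr2.
    have cr' : re (v (k + n)%N x) @[k --> \oo] --> re (g x).
      by rewrite (cvg_shiftn n (fun k => re (v k x))).
    have ci' : im (v (k + n)%N x) @[k --> \oo] --> im (g x).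
      by rewrite (cvg_shiftn n (fun k => im (v k x))).
    by apply: cvgD; apply: cvgM; apply: cvgB => //; exact: cvg_cst.
  by apply: (cvgr_to_le lim); apply: nearW => k; exact: bound.
have rS : rint (fun x => fine (S x)).
  apply: (le_integrable measurableT _ _ iS).
    by apply/measurable_EFinP; apply: measurableT_comp mS; exact: fine_measurable.
  move=> x _ /=; rewrite gee0_abs // ger0_norm ?fine_ge0 //.
  by case: (S x) (S0 x) => [r||] //= _; rewrite leey.
have IfS : \int[leb]_x fine (S x) <= 2.
  rewrite -lee_fin /Rintegral fineK; last exact: (integrable_fin_num measurableT rS).
  apply: le_trans IS; apply: ge0_le_integral => //.
  - by move=> x _; rewrite lee_fin fine_ge0.
  - by have /measurable_EFinP := rint_measurable rS.
  - by move=> x _; case: (S x) (S0 x) => [r||] //= _; rewrite leey.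
have mB f h : cmeas f -> cmeas h -> cmeas (fun x => f x - h x).
  move=> mf mh; rewrite (_ : (fun x => _) = fun x => f x + -1 * h x).
    by apply: cmeasD => //; apply: cmeasM => //; exact: cmeas_cst.
  by apply/funext => x; rewrite mulN1r.
have Lv n : L2 (v n).
  apply: (L2_le (mv n) (L2_rint (Lu n))) => x.
  rewrite /v ncM nc_real exprMn /c indicE; case: (_ \in _) => /=.
    by rewrite normr1 expr1n mul1r.
  by rewrite normr0 expr0n mul0r sqr_ge0.
have Lgv n : L2 (fun x => g x - v n x).
  exact: (L2_le (mB _ _ mg (mv n)) (rintZ (2 / 2 ^+ n) rS) (gbound n)).
have Lg : L2 g.
  rewrite (_ : g = fun x => (g x - v 0%N x) + v 0%N x); first exact: L2D.
  by apply/funext => x; rewrite subrK.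
exists g => // n.
rewrite (@n2_ae _ _ (fun x => g x - v n x)) //; [|exact: L2B|].
  apply: le_trans (n2_le (mB _ _ mg (mv n)) (rintZ (2 / 2 ^+ n) rS) (gbound n)) _.
  rewrite RintegralZT //; apply: le_trans (ler_wpM2l _ IfS) _.
    by rewrite divr_ge0 ?exprn_ge0.
  by rewrite mulrAC -natrM.
have := integrable_ae measurableT iS; apply: ae_imp => x /(_ I) fx.
by rewrite /v /c indicE mem_set // mul1r.
Qed.

End Completeness.

(** * Extension of a Schwartz isometry to a unitary operator *)

Section UnitaryExtension.
Context {R : realType}.
Implicit Types (f g h s u : R -> R[i]) (x : R) (z w : R[i]).
Local Notation re := (@complex.Re R).
Local Notation im := (@complex.Im R).
Local Notation nc := (@ComplexField.Normc.normc R).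
Local Notation leb := (@lebesgue_measure R).

(** [P] is a relation so that the graph of [T] can be read in both directions: forwards it gives the
    extension, backwards its surjectivity. *)
Lemma isometric_limit (P : (R -> R[i]) -> (R -> R[i]) -> Prop) f :
  (forall s, schwartz s -> exists2 s', schwartz s' & P s s') ->
  (forall s s' u u', schwartz s -> schwartz s' -> schwartz u -> schwartz u' ->
    P s s' -> P u u' -> n2 (fun x => s' x - u' x) = n2 (fun x => s x - u x)) ->
  L2 f -> exists2 g, L2 g & forall eps : R, 0 < eps -> exists s s',
    [/\ schwartz s, schwartz s', P s s', n2 (fun x => f x - s x) < eps &
        n2 (fun x => g x - s' x) < eps].
Proof.
move=> Pex Piso Lf; have [_ fS] := schwartz_dense Lf.
(* Successive approximations then differ by at most [2 (4^-(n+2) + 4^-(n+1)) < 4^-n] in [n2], as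
   [L2_complete] requires. *)
pose e n : R := (4^-1) ^+ n.+1.
have e0 n : 0 < e n by rewrite exprn_gt0.
have /choice[p hp] : forall n, exists q : (R -> R[i]) * (R -> R[i]),
    [/\ schwartz q.1, schwartz q.2, P q.1 q.2 & n2 (fun x => f x - q.1 x) < e n].
  move=> n; have [s ss fs] := fS _ (e0 n); have [s' ss' Ps] := Pex _ ss.
  by exists (s, s').
have Lp n : L2 (p n).1 by have [? _ _ _] := hp n; exact: L2_schwartz.
have Lp' n : L2 (p n).2 by have [_ ? _ _] := hp n; exact: L2_schwartz.
have dp n : n2 (fun x => (p n.+1).2 x - (p n).2 x) <= (4^-1) ^+ n.
  have [s1 s2 s3 s4] := hp n; have [t1 t2 t3 t4] := hp n.+1.
  rewrite (Piso _ _ _ _ t1 t2 s1 s2 t3 s3).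
  apply: le_trans (n2B (Lp n.+1) Lf (Lp n)) _; rewrite n2C.
  have q0 : 0 < (4^-1) ^+ n :> R by rewrite exprn_gt0.
  move: s4 t4; rewrite /e !exprS; lra.
have [g Lg gp] := L2_complete Lp' dp.
exists g => // eps eps0.
have [n hn] : exists n : nat, 4 / eps < n%:R.
  have [n _ hn] := @nbhs_infty_gtr R (4 / eps).
  by exists n; exact: hn (leqnn n).
have n2n : n%:R <= 2 ^+ n :> R by rewrite -natrX ler_nat ltnW // ltn_expl.
have p0 : 0 < 2 ^+ n :> R by rewrite exprn_gt0.
have lt_eps : 4 / 2 ^+ n < eps.
  by rewrite ltr_pdivrMr // mulrC -ltr_pdivrMr //; exact: lt_le_trans hn n2n.
have [s1 s2 s3 s4] := hp n; exists (p n).1, (p n).2; split=> //.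
  apply: lt_trans s4 _; apply: le_lt_trans lt_eps.
  rewrite /e exprS exprVn.
  have h1 : (4 ^+ n)^-1 <= (2 ^+ n)^-1 :> R.
    by rewrite lef_pV2 ?posrE ?exprn_gt0 // lerXn2r ?nnegrE // ler_nat.
  have h2 : 0 <= (2 ^+ n)^-1 :> R by rewrite invr_ge0 ltW.
  lra.
exact: le_lt_trans (gp n) lt_eps.
Qed.

Variable T : (R -> R[i]) -> (R -> R[i]).
Hypothesis T_schwartz : forall s, schwartz s -> schwartz (T s).
Hypothesis T_n2 : forall s, schwartz s -> n2 (T s) = n2 s.
Hypothesis T_lin : forall z s u, schwartz s -> schwartz u ->
  T (fun x => z * s x + u x) = fun x => z * T s x + T u x.
Hypothesis T_onto : forall s, schwartz s -> exists2 u, schwartz u & T u = s.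

(* The closure in L2 x L2 of the graph of [T] on Schwartz functions. *)
Definition limit_pair f g : Prop := [/\ L2 f, L2 g &
  forall eps : R, 0 < eps -> exists2 s, schwartz s &
    n2 (fun x => f x - s x) < eps /\ n2 (fun x => g x - T s x) < eps].

Let T_B s u : schwartz s -> schwartz u ->
  T (fun x => s x - u x) = fun x => T s x - T u x.
Proof.
move=> ss su; have -> : (fun x => s x - u x) = fun x => -1 * u x + s x.
  by apply/funext => x; rewrite mulN1r addrC.
by rewrite T_lin //; apply/funext => x; rewrite mulN1r addrC.
Qed.

Let T_iso s u : schwartz s -> schwartz u ->
  n2 (fun x => T s x - T u x) = n2 (fun x => s x - u x).
Proof. by move=> ss su; rewrite -T_B // T_n2 //; exact: schwartzB. Qed.

Lemma limit_pair_exists f : L2 f -> exists g, limit_pair f g.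
Proof.
move=> Lf; have [|| g Lg fg] := @isometric_limit (fun s s' => s' = T s) f _ _ Lf.
- by move=> s ss; exists (T s) => //; exact: T_schwartz.
- by move=> s s' u u' ss _ su _ -> ->; exact: T_iso.
exists g; split=> // eps e0; have [s [s' [ss _ -> h1 h2]]] := fg _ e0.
by exists s.
Qed.

Lemma limit_pair_onto g : L2 g -> exists f, limit_pair f g.
Proof.
move=> Lg; have [|| f Lf fg] := @isometric_limit (fun s s' => s = T s') g _ _ Lg.
- by move=> s ss; have [u su us] := T_onto ss; exists u.
- by move=> s s' u u' _ ss _ su -> ->; rewrite T_iso.
exists f; split=> // eps e0; have [s [s' [_ ss' -> h1 h2]]] := fg _ e0.
by exists s'.
Qed.

Lemma limit_pair_schwartz s : schwartz s -> limit_pair s (T s).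
Proof.
move=> ss; split; [exact: L2_schwartz|exact/L2_schwartz/T_schwartz|].
move=> eps e0; exists s => //.
have z0 h : n2 (fun x => h x - h x) = 0.
  rewrite (_ : (fun x => _) = fun=> 0); last by apply/funext => x; rewrite subrr.
  by rewrite /n2 ComplexField.Normc.normc0 expr0n Rintegral_cst // mul0r.
by rewrite !z0.
Qed.

(** The isometry on Schwartz functions passes to the closure of the graph. This single statement
    yields well-definedness on classes, linearity, agreement with [T] and surjectivity. *)
Lemma limit_pair_unique f f' g g' : limit_pair f g -> limit_pair f' g' ->
  L2eq f f' -> L2eq g g'.
Proof.
move=> [Lf Lg fg] [Lf' Lg' fg'] ff'.
have Lgg := L2B Lg Lg'.
suff : n2 (fun x => g x - g' x) = 0.
  by move/(n2_eq0 Lgg); apply: ae_imp => x /eqP; rewrite subr_eq0 => /eqP.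
apply/eqP; rewrite eq_le n2_ge0 andbT; apply/ler_addgt0Pl => eps e0; rewrite addr0.
have e1 : 0 < eps / 100 by rewrite divr_gt0.
have [s ss [fs gs]] := fg _ e1; have [u su [fu gu]] := fg' _ e1.
have [LTs LTu] := (L2_schwartz (T_schwartz ss), L2_schwartz (T_schwartz su)).
have [Ls Lu] := (L2_schwartz ss, L2_schwartz su).
have h1 := n2B Lg LTs Lg'; have h2 := n2B LTs LTu Lg'.
have h3 := n2B Ls Lf Lu; rewrite [n2 (fun x => T u x - g' x)]n2C in h2.
rewrite [n2 (fun x => s x - f x)]n2C in h3.
have h4 : n2 (fun x => f x - u x) = n2 (fun x => f' x - u x).
  apply: n2_ae; [exact: L2B|exact: L2B|].
  by apply: ae_imp ff' => x ->.
rewrite h4 in h3; rewrite T_iso // in h2; lra.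
Qed.

Lemma limit_pair_lin z f f' g g' : limit_pair f g -> limit_pair f' g' ->
  limit_pair (fun x => z * f x + f' x) (fun x => z * g x + g' x).
Proof.
move=> [Lf Lg fg] [Lf' Lg' fg']; split; [by apply: L2D => //; exact: L2Z..|].
move=> eps e0.
have K0 : 0 < 2 * nc z ^+ 2 + 2 by have := sqr_ge0 (nc z); lra.
have e1 : 0 < eps / (2 * nc z ^+ 2 + 2) by rewrite divr_gt0.
have [s ss [fs gs]] := fg _ e1; have [u su [fu gu]] := fg' _ e1.
have key (a b c d : R -> R[i]) : L2 a -> L2 b -> L2 c -> L2 d ->
    n2 (fun x => a x - c x) < eps / (2 * nc z ^+ 2 + 2) ->
    n2 (fun x => b x - d x) < eps / (2 * nc z ^+ 2 + 2) ->
    n2 (fun x => z * a x + b x - (z * c x + d x)) < eps.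
  move=> La Lb Lc Ld ac bd.
  rewrite (_ : (fun x => _) = fun x => z * (a x - c x) + (b x - d x)); last first.
    by apply/funext => x; ring.
  apply: le_lt_trans (n2D ltr01 (L2Z z (L2B La Lc)) (L2B Lb Ld)) _.
  rewrite invr1 n2Z; last exact: L2B.
  have h1 := ler_wpM2l (sqr_ge0 (nc z)) (ltW ac).
  apply: lt_le_trans (_ : 2 * (nc z ^+ 2 * (eps / (2 * nc z ^+ 2 + 2))) +
     2 * (eps / (2 * nc z ^+ 2 + 2)) <= _); first by lra.
  by rewrite le_eqVlt; apply/orP; left; apply/eqP; field; rewrite gt_eqF.
exists (fun x => z * s x + u x); first exact: schwartz_lin.
rewrite T_lin //; split; apply: key => //; do ?exact: L2_schwartz.
  exact/L2_schwartz/T_schwartz.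
exact/L2_schwartz/T_schwartz.
Qed.

(** The factors [1 + d] are removed in two limits: the approximation error tends to 0 for fixed [d],
    and then [d] tends to 0. The hypothesis of [le_n2] is symmetric enough to give both
    inequalities. *)
Lemma limit_pair_n2 f g : limit_pair f g -> n2 g = n2 f.
Proof.
move=> [Lf Lg fg].
have le_n2 a b : L2 a -> L2 b -> (forall eps : R, 0 < eps -> exists s u,
    [/\ L2 s, L2 u, n2 u = n2 s & n2 (fun x => a x - s x) < eps /\
      n2 (fun x => b x - u x) < eps]) -> n2 a <= n2 b.
  move=> La Lb ab.
  have step d eps : 0 < d -> 0 < eps ->
      n2 a <= (1 + d) * ((1 + d) * n2 b + (1 + d^-1) * eps) + (1 + d^-1) * eps.
    move=> d0 e0; have [s [u [Ls Lu us [h1 h2]]]] := ab _ e0.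
    have h3 := n2D d0 Ls (L2B La Ls); have h4 := n2D d0 Lb (L2B Lu Lb).
    rewrite n2C in h2.
    rewrite (_ : (fun x => s x + _) = a) in h3; last by apply/funext => x; ring.
    rewrite (_ : (fun x => b x + _) = u) in h4; last by apply/funext => x; ring.
    have dV : 0 < 1 + d^-1 by rewrite addr_gt0 ?invr_gt0.
    have dp : 0 < 1 + d by rewrite addr_gt0.
    have h5 := ler_wpM2l (ltW dV) (ltW h1); have h6 := ler_wpM2l (ltW dV) (ltW h2).
    rewrite us in h4.
    apply: le_trans h3 _; apply: lerD => //; rewrite ler_pM2l //.
    by apply: le_trans h4 _; rewrite lerD2l.
  have step2 d : 0 < d -> n2 a <= (1 + d) * ((1 + d) * n2 b).
    move=> d0; apply/ler_addgt0Pl => eps e0; rewrite addrC.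
    have dV : 0 < 1 + d^-1 by rewrite addr_gt0 ?invr_gt0.
    have dp : 0 < 1 + d by rewrite addr_gt0.
    have c0 : 0 < (1 + d) * (1 + d^-1) + (1 + d^-1) by rewrite addr_gt0 ?mulr_gt0.
    pose q := eps / ((1 + d) * (1 + d^-1) + (1 + d^-1)).
    have q0 : 0 < q by rewrite divr_gt0.
    have cq : ((1 + d) * (1 + d^-1) + (1 + d^-1)) * q = eps.
      by rewrite mulrC divfK // gt_eqF.
    apply: le_trans (step d q d0 q0) _; rewrite -cq le_eqVlt.
    by clearbody q; apply/orP; left; apply/eqP; ring.
  apply/ler_addgt0Pl => eps e0; rewrite addrC.
  have b0 := n2_ge0 b.
  (* For [d <= 1] one has [(1 + d)^2 <= 1 + 3 d], and the second bound makes [3 d * n2 b] at most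
     [eps]. *)
  pose d := Num.min 1 (eps / (3 * n2 b + 1)).
  have c0 : 0 < 3 * n2 b + 1 by lra.
  have d0 : 0 < d by rewrite lt_min ltr01 divr_gt0.
  have d1 : d <= 1 by rewrite ge_min lexx.
  have d2 : d * (3 * n2 b + 1) <= eps.
    by rewrite -ler_pdivlMr // ge_min lexx orbT.
  have := step2 d d0; have := mulr_ge0 (ltW d0) b0 => db h.
  apply: le_trans h _; nra.
apply/eqP; rewrite eq_le; apply/andP; split; apply: le_n2 => // eps e0;
  have [s ss [h1 h2]] := fg _ e0.
  exists (T s), s; split => //; [|exact: L2_schwartz|by rewrite T_n2].
  exact/L2_schwartz/T_schwartz.
exists s, (T s); split => //; [exact: L2_schwartz| |by rewrite T_n2].
exact/L2_schwartz/T_schwartz.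
Qed.

Let Cint_ip f g : L2 f -> L2 g -> Cint (fun x => f x * conjc (g x)).
Proof.
move=> /L2P[mf rf] /L2P[mg rg].
apply: (Cint_le (cmeasM mf (cmeasJ mg)) _ (rintD rf rg)) => x.
rewrite ncM ncJ; have := sqr_ge0 (nc (f x) - nc (g x)).
by have := sqr_ge0 (nc (f x)); have := sqr_ge0 (nc (g x)); nra.
Qed.

(** Polarisation: [z = 1] and [z = i] recover the real and imaginary parts of the inner product from
    [n2], so preserving [n2] preserves inner products. *)
Lemma n2_lin z f g : L2 f -> L2 g ->
  n2 (fun x => z * f x + g x) = nc z ^+ 2 * n2 f + n2 g + 2 * re (z * L2inner f g).
Proof.
move=> Lf Lg; have ip := Cint_ip Lf Lg.
rewrite /L2inner -CintegralZ //=; have [ipr _] := CintZ z ip.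
have [rf rg] := (L2_rint Lf, L2_rint Lg).
rewrite /n2 -!RintegralZT // -RintegralDT //; last exact: rintZ.
rewrite -RintegralDT; [|by apply: rintD => //; exact: rintZ|exact: rintZ].
apply: eq_Rintegral => x _; rewrite !sqr_nc !reimE /=; ring.
Qed.

Lemma unitary_extension : exists U : (R -> R[i]) -> (R -> R[i]),
  L2_unitary U /\ forall s, schwartz s -> L2 s /\ L2eq (U s) (T s).
Proof.
have /choice[U hU] : forall f, exists g, L2 f -> limit_pair f g.
  (* Outside [L2] the implication is vacuous and any value serves. *)
  move=> f; have [Lf|nLf] := pselect (L2 f); last by exists f.
  by have [g fg] := limit_pair_exists Lf; exists g.
have refl f : L2eq f f by apply: aeW.
have LU f : L2 f -> L2 (U f) by move=> /hU[].
have Ulin a f g : L2 f -> L2 g ->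
    L2eq (U (fun x => a * f x + g x)) (fun x => a * U f x + U g x).
  move=> Lf Lg; apply: limit_pair_unique (refl _).
    by apply: hU; apply: L2D => //; exact: L2Z.
  by apply: limit_pair_lin; exact: hU.
have Un2 f : L2 f -> n2 (U f) = n2 f by move=> Lf; exact/limit_pair_n2/hU.
exists U; split; last first.
  move=> s ss; split; first exact: L2_schwartz.
  apply: limit_pair_unique (refl s); last exact: limit_pair_schwartz.
  exact/hU/L2_schwartz.
split=> //.
- split=> // f g Lf Lg fg.
  exact: limit_pair_unique (hU _ Lf) (hU _ Lg) fg.
- move=> f g Lf Lg.
  have re_ip z : re (z * L2inner (U f) (U g)) = re (z * L2inner f g).
    have h1 := n2_lin z Lf Lg; have h2 := n2_lin z (LU _ Lf) (LU _ Lg).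
    rewrite -(n2_ae _ _ (Ulin z f g Lf Lg)) in h2; last first.
    + by apply: L2D; [apply: L2Z|]; exact: LU.
    + by apply: LU; apply: L2D => //; exact: L2Z.
    rewrite Un2 in h2; last by apply: L2D => //; exact: L2Z.
    rewrite !Un2 // h1 in h2; lra.
  apply: complex_eq; first by have := re_ip 1; rewrite !mul1r.
  have := re_ip 'i; rewrite !reM /= !mul0r !mul1r !sub0r; exact: oppr_inj.
- move=> g Lg; have [f fg] := limit_pair_onto Lg.
  have [Lf _ _] := fg; exists f => //.
  exact: limit_pair_unique (hU _ Lf) fg (refl f).
Qed.

End UnitaryExtension.

(** * Unitarity of [H] and conclusion *)

Section HUnitary.
Context {R : realType}.

Lemma n2_Cintegral (f : R -> R[i]) : L2 f ->
  Cintegral (fun x => f x * conjc (f x)) = (n2 f)%:C.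
Proof.
move=> Lf; apply: complex_eq => /=.
  by apply: eq_Rintegral => x _; rewrite sqr_nc !reimE; ring.
rewrite -[RHS](mul0r (fine (@lebesgue_measure R setT))) -Rintegral_cst //.
by apply: eq_Rintegral => x _; rewrite !reimE; ring.
Qed.

Lemma n2_H (mu : R) f : 0 < mu -> schwartz f -> n2 (H mu f) = n2 f.
Proof.
move=> mu0 sf; apply: complexI; have sH := schwartz_H mu0 sf.
rewrite -!n2_Cintegral; [exact: H_Parseval|exact: L2_schwartz..].
Qed.

End HUnitary.

Unset Implicit Arguments.

Theorem theorem1 (R : realType) (mu : R) (mu_gt0 : 0 < mu) :
  (forall f : R -> R[i], schwartz f -> schwartz (H mu f)) /\
  (forall f : R -> R[i], schwartz f ->
     forall t : R, iter 3 (H mu) f t = f (- t)) /\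
  (forall f : R -> R[i], schwartz f -> iter 6 (H mu) f = f) /\
  (exists U : (R -> R[i]) -> (R -> R[i]),
     L2_unitary U /\
     (forall f : R -> R[i], schwartz f -> L2 f /\ L2eq (U f) (H mu f))) /\
  (forall f : R -> R[i], schwartz f ->
     forall t : R,
       iter 2 (H mu) f t =
       (Num.sqrt (2 * mu))%:C / i_root6 * e (mu * t ^+ 2) *
       Cintegral (fun x => f x * e (2 * mu * t * x))).
Proof.
split; first by move=> f; exact: schwartz_H.
split; first by move=> f sf t; exact: H_iter3.
split; first by move=> f; exact: H_iter6.
split; last by move=> f sf t; exact: H_iter2E.
apply: unitary_extension.
- by move=> s; exact: schwartz_H.
- by move=> s; exact: n2_H.
- by move=> z s u ss su; exact: H_lin.
- move=> s ss; exists (iter 5 (H mu) s); first exact: schwartz_iter_H.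
  exact: H_iter6.
Qed.
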